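(* (i) For even $n\ge4$, the implicitly defined curves $G_{n,n-2}=0$, $E_{n-2}=0$, $E_{n,n-2}=0$, $H_{n,n-2}=0$, and $G_{n+2,n}=0$ are monotonically ordered, from highest to lowest, in $\{(\rho,\phi)\in(0,1)\times(2/3,3/4):\phi<\phi_2\}$. More precisely, for $n=4,6,8,\ldots$: $G_{n,n-2}=0$ is above $E_{n-2}=0$; $E_{n-2}=0$ is above $E_{n,n-2}=0$; $E_{n,n-2}=0$ is above $H_{n,n-2}=0$; and $H_{n,n-2}=0$ is above $G_{n+2,n}=0$. Furthermore, the functions defining the curves are positive above, and negative below, the curves. (ii) For even $n\ge2$ and $(\rho,\phi)\in(0,1)\times(2/3,1]$, the greedy strategy leads to the periodic pattern $[1,n]$ starting from the corresponding stationary distribution $\boldsymbol\pi_{[1,n]}$ as the initial state if and only if $E_{n,n-2}<0$ and $E_n\ge0$. ($E_{2,0}<0$ is automatically satisfied.) (iii) For even $n\ge4$ and $(\rho,\phi)\in(0,1)\times(2/3,1]$, the greedy strategy leads to the periodic pattern $[1,n,1,n-2]$ starting from the corresponding stationary distribution $\boldsymbol\pi_{[1,n,1,n-2]}$ as the initial state if and only if $G_{n,n-2}<0$ and $H_{n,n-2}\ge0$.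
   Context: Fix $\rho\in(0,1)$ and $\phi\in(0,1]$. Put $p_0:=\rho^2/(1+\rho^2)$, $p_1:=1/(1+\rho)$, $$\boldsymbol P_B^\circ:=\begin{pmatrix}0&p_0&1-p_0\\ 1-p_1&0&p_1\\ p_1&1-p_1&0\end{pmatrix},\qquad \boldsymbol P_A^\circ:=\begin{pmatrix}0&1/2&1/2\\ 1/2&0&1/2\\ 1/2&1/2&0\end{pmatrix},$$ $\boldsymbol P_A:=(1-\phi)\boldsymbol I+\phi\boldsymbol P_A^\circ$, $\boldsymbol P_B:=(1-\phi)\boldsymbol I+\phi\boldsymbol P_B^\circ$, and $\pi_0:=\frac{1+\rho^2}{2(1+\rho+\rho^2)}$ (the first coordinate of the stationary distribution of $\boldsymbol P_B$). Let $\Delta:=\{(x_0,x_1,x_2):x_i\ge0,\ x_0+x_1+x_2=1\}$ (row vectors), $\Delta_A:=\{x\in\Delta:x_0\ge\pi_0\}$, $\Delta_B:=\Delta-\Delta_A$. The greedy strategy is the discrete dynamical system $x(n+1)=F(x(n))$, where $F(x):=x\boldsymbol P_A$ if $x\in\Delta_A$ (game $A$ is played) and $F(x):=x\boldsymbol P_B$ if $x\in\Delta_B$ (game $B$ is played). Periodic pattern $[1,n]$: the sequence of games played is $AB^nAB^nAB^n\cdots$ (one play of $A$ followed by $n$ plays of $B$, repeated forever). Periodic pattern $[1,n,1,n-2]$: the sequence of games played is $AB^nAB^{n-2}$ repeated forever. $\boldsymbol\pi_{[1,n]}$ is the stationary distribution of $\boldsymbol P_A\boldsymbol P_B^n$,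 and $\boldsymbol\pi_{[1,n,1,n-2]}$ is the stationary distribution of $\boldsymbol P_A\boldsymbol P_B^n\boldsymbol P_A\boldsymbol P_B^{n-2}$. Put $S:=\sqrt{(1+\rho^2)(1+4\rho+\rho^2)}$, $$\phi_2:=\frac{2(1+\rho)(1+\rho^2)}{3(1+\rho)(1+\rho^2)-(1-\rho)S},$$ and let $$e_1:=1-\phi+\phi\Big(-\tfrac12+\tfrac{(1-\rho)S}{2(1+\rho)(1+\rho^2)}\Big),\qquad e_2:=1-\phi+\phi\Big(-\tfrac12-\tfrac{(1-\rho)S}{2(1+\rho)(1+\rho^2)}\Big)$$ be the nonunit eigenvalues of $\boldsymbol P_B$. With $K_\pm:=3(1+\rho)(1+\rho^2)\pm(1-\rho)S$, define the following functions of $(\rho,\phi)$ (with zeroth powers equal to 1): $$E_{n,m}:=\tfrac12\phi(1-\rho)\{e_2^m[2+e_1^n(3\phi-2)]K_--e_1^m[2+e_2^n(3\phi-2)]K_+\},\qquad E_n:=E_{n,n},$$ $$G_{n,m}:=\phi(1-\rho)\{e_2^m[4-e_1^{2(n-1)}(3\phi-2)^2][2-e_2^{n-2}(3\phi-2)]K_--e_1^m[4-e_2^{2(n-1)}(3\phi-2)^2][2-e_1^{n-2}(3\phi-2)]K_+\},$$ $$H_{n,m}:=\phi(1-\rho)\{e_2^m[4-e_1^{2(n-1)}(3\phi-2)^2][2-e_2^n(3\phi-2)]K_--e_1^m[4-e_2^{2(n-1)}(3\phi-2)^2][2-e_1^n(3\phi-2)]K_+\}.$$ ''Above'', ''below'',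 ''highest'', ''lowest'' refer to the $(\rho,\phi)$-plane with $\rho$ horizontal and $\phi$ vertical: one curve is above another if, at each $\rho$, its $\phi$-value is larger. *)

(* Defs.v *)
From mathcomp Require Import all_boot all_order all_algebra.
From mathcomp Require Import reals.

Set Implicit Arguments.
Unset Strict Implicit.
Unset Printing Implicit Defensive.

Import Order.TTheory GRing.Theory Num.Theory.
Local Open Scope ring_scope.

Definition mx3 {R : realType} (rows : seq (seq R)) : 'M[R]_3 :=
  \matrix_(i < 3, j < 3) (nth [::] rows i)`_j.

Definition p0 {R : realType} (rho : R) : R := rho ^+ 2 / (1 + rho ^+ 2).
Definition p1 {R : realType} (rho : R) : R := 1 / (1 + rho).

Definition PB0 {R : realType} (rho : R) : 'M[R]_3 :=
  mx3 [:: [:: 0;           p0 rho;      1 - p0 rho];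
          [:: 1 - p1 rho;  0;           p1 rho];
          [:: p1 rho;      1 - p1 rho;  0]].

Definition PA0 {R : realType} : 'M[R]_3 :=
  mx3 [:: [:: 0;      1 / 2;  1 / 2];
          [:: 1 / 2;  0;      1 / 2];
          [:: 1 / 2;  1 / 2;  0]].

Definition PA {R : realType} (phi : R) : 'M[R]_3 := (1 - phi)%:M + phi *: PA0.
Definition PB {R : realType} (rho phi : R) : 'M[R]_3 :=
  (1 - phi)%:M + phi *: PB0 rho.

Definition pi0 {R : realType} (rho : R) : R :=
  (1 + rho ^+ 2) / (2 * (1 + rho + rho ^+ 2)).

Definition in_simplex {R : realType} (x : 'rV[R]_3) : Prop :=
  (forall i, 0 <= x 0 i) /\ \sum_i x 0 i = 1.

Definition stationary {R : realType} (P : 'M[R]_3) (x : 'rV[R]_3) : Prop :=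
  in_simplex x /\ x *m P = x.

Inductive game := GameA | GameB.

(* The definitions below make sense on all row vectors; they are only applied
   to points of the simplex, which [greedy_step] preserves. *)
Definition greedy_game {R : realType} (rho : R) (x : 'rV[R]_3) : game :=
  if pi0 rho <= x 0 0 then GameA else GameB.

Definition greedy_step {R : realType} (rho phi : R) (x : 'rV[R]_3) : 'rV[R]_3 :=
  match greedy_game rho x with
  | GameA => x *m PA phi
  | GameB => x *m PB rho phi
  end.

(* Started at x, the greedy strategy plays, from the very first step, the
   games listed in the (nonempty) block [s], repeated forever. *)
Definition greedy_leads_to {R : realType} (rho phi : R)
    (s : seq game) (x : 'rV[R]_3) : Prop :=
  forall k : nat,
    greedy_game rho (iter k (greedy_step rho phi) x)
      = nth GameA s (k %% size s)%N.

(* One period of the pattern [1, n], i.e. A B^n. *)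
Definition pattern1n (n : nat) : seq game := GameA :: nseq n GameB.

Definition Srho {R : realType} (rho : R) : R :=
  Num.sqrt ((1 + rho ^+ 2) * (1 + 4 * rho + rho ^+ 2)).

Definition phi2 {R : realType} (rho : R) : R :=
  2 * (1 + rho) * (1 + rho ^+ 2)
    / (3 * (1 + rho) * (1 + rho ^+ 2) - (1 - rho) * Srho rho).

Definition e1 {R : realType} (rho phi : R) : R :=
  1 - phi + phi * (- (1 / 2)
    + (1 - rho) * Srho rho / (2 * (1 + rho) * (1 + rho ^+ 2))).

Definition e2 {R : realType} (rho phi : R) : R :=
  1 - phi + phi * (- (1 / 2)
    - (1 - rho) * Srho rho / (2 * (1 + rho) * (1 + rho ^+ 2))).

Definition Kplus {R : realType} (rho : R) : R :=
  3 * (1 + rho) * (1 + rho ^+ 2) + (1 - rho) * Srho rho.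
Definition Kminus {R : realType} (rho : R) : R :=
  3 * (1 + rho) * (1 + rho ^+ 2) - (1 - rho) * Srho rho.

Definition E {R : realType} (n m : nat) (rho phi : R) : R :=
  1 / 2 * phi * (1 - rho) *
  (e2 rho phi ^+ m * (2 + e1 rho phi ^+ n * (3 * phi - 2)) * Kminus rho
   - e1 rho phi ^+ m * (2 + e2 rho phi ^+ n * (3 * phi - 2)) * Kplus rho).

(* [n - 1] and [n - 2] are truncated; G is only used with n >= 2. *)
Definition G {R : realType} (n m : nat) (rho phi : R) : R :=
  phi * (1 - rho) *
  (e2 rho phi ^+ m
     * (4 - e1 rho phi ^+ (2 * (n - 1)) * (3 * phi - 2) ^+ 2)
     * (2 - e2 rho phi ^+ (n - 2) * (3 * phi - 2)) * Kminus rho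
   - e1 rho phi ^+ m
     * (4 - e2 rho phi ^+ (2 * (n - 1)) * (3 * phi - 2) ^+ 2)
     * (2 - e1 rho phi ^+ (n - 2) * (3 * phi - 2)) * Kplus rho).

Definition H {R : realType} (n m : nat) (rho phi : R) : R :=
  phi * (1 - rho) *
  (e2 rho phi ^+ m
     * (4 - e1 rho phi ^+ (2 * (n - 1)) * (3 * phi - 2) ^+ 2)
     * (2 - e2 rho phi ^+ n * (3 * phi - 2)) * Kminus rho
   - e1 rho phi ^+ m
     * (4 - e2 rho phi ^+ (2 * (n - 1)) * (3 * phi - 2) ^+ 2)
     * (2 - e1 rho phi ^+ n * (3 * phi - 2)) * Kplus rho).

Definition region {R : realType} (rho phi : R) : Prop :=
  0 < rho < 1 /\ 2 / 3 < phi < 3 / 4 /\ phi < phi2 rho.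

(* The zero set of F in the region is the graph of c : (0,1) -> R; the values
   of c outside (0,1) are irrelevant. *)
Definition implicit_curve {R : realType} (F : R -> R -> R) (c : R -> R) : Prop :=
  forall rho, 0 < rho < 1 ->
    region rho (c rho) /\
    forall phi, region rho phi -> (F rho phi = 0 <-> phi = c rho).

Definition pos_above_neg_below {R : realType} (F : R -> R -> R) (c : R -> R) :
    Prop :=
  forall rho phi, region rho phi ->
    (c rho < phi -> 0 < F rho phi) /\ (phi < c rho -> F rho phi < 0).

Definition above {R : realType} (c d : R -> R) : Prop :=
  forall rho, 0 < rho < 1 -> d rho < c rho.

(* Main.v *)
Require Import Defs.
From mathcomp Require Import all_boot all_order all_algebra.
From mathcomp Require Import boolp reals.
From mathcomp Require Import ring lra zify.

Set Implicit Arguments.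
Unset Strict Implicit.
Unset Printing Implicit Defensive.

Import Order.TTheory GRing.Theory Num.Theory.
Local Open Scope ring_scope.

(** Put [a = e1], [b = - e2] and [c = 3 phi - 2 = b - a], so that [b > |a|].
    Since [phi K_- = N (1 - e1)] and [phi K_+ = N (1 - e2)] with
    [N = 2 (1 + rho) (1 + rho^2)], each of E, G and H is a positive multiple of
    [e2^m (4 - e1^(2l) c^2) (2 - e2^k c) (1 - e1)
     - e1^m (4 - e2^(2l) c^2) (2 - e1^k c) (1 - e2)],
    with (l, k) equal to (n, n) for E_{n,m}, (n-1, n-2) for G_{n,m} and
    (n-1, n) for H_{n,m}.

    For part (i), the quotient of the two terms increases with phi at fixed rho,
    so each function changes sign exactly once; the curves are ordered by
    comparing these quotients for consecutive functions.

    For parts (ii) and (iii), let [dev x = x_0 - pi_0] on the simplex.  The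
    functionals [dev (x P_B) - e_j dev x] are multiplied by the other nonunit
    eigenvalue under P_B and transformed affinely, with ratio [- c / 2], under
    P_A.  Periodicity then determines them at the stationary distribution, and
    the value of [dev] after each play is a positive multiple of the expression
    above, with [m] the number of plays of B since the last play of A.  The
    sign conditions along a whole period reduce to the extreme ones; when
    [a <= 0] and [n >= 4] the condition indexed by [n - 2] fails. *)

(** * Sign analysis of the common form of E, G and H *)

(** In quotient form this is the chain [q / p <= u / v < u' / v']. It exchanges one pair of factors
    of [bal] for another while the rest, [p] and [q], stays fixed. *)
Lemma lt_cross_transfer (R : realFieldType) (p q u v u' v' : R) :
  0 < p -> 0 < v -> 0 < v' -> u * v' < u' * v -> q * v <= p * u -> q * v' < p * u'.
Proof.
move=> p0 v0 v'0 huv hpq; rewrite -(ltr_pM2r v0).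
have h1 : p * (u * v') < p * (u' * v) by rewrite ltr_pM2l.
have h2 : q * v * v' <= p * u * v' by rewrite ler_pM2r.
by apply: (le_lt_trans (y := p * u * v')); [rewrite mulrAC|rewrite -!mulrA].
Qed.

Lemma le_cross_transfer (R : realFieldType) (p q u v u' v' : R) :
  0 <= p -> 0 < v -> 0 <= v' -> u * v' <= u' * v -> q * v <= p * u -> q * v' <= p * u'.
Proof.
move=> p0 v0 v'0 huv hpq; rewrite -(ler_pM2r v0).
have h1 : p * (u * v') <= p * (u' * v) by rewrite ler_wpM2l.
have h2 : q * v * v' <= p * u * v' by rewrite ler_wpM2r.
by apply: (le_trans (y := p * u * v')); [rewrite mulrAC|rewrite -!mulrA].
Qed.

(** The induction step bounds the difference by [y * (y - x)] plus [x ^+ k.+1 * (y - x)], which is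
    at most [(x + y) * (y - x)]. *)
Lemma subr_exp_le (R : realFieldType) (x y : R) (k : nat) :
  0 <= x -> x <= y -> x + y <= 1 -> y ^+ k - x ^+ k <= y - x.
Proof.
move=> x0 xy xy1; case: k => [|k]; first by rewrite !expr0; lra.
elim: k => [|k IH]; first by rewrite !expr1.
have -> : y ^+ k.+2 - x ^+ k.+2 = y * (y ^+ k.+1 - x ^+ k.+1) + x ^+ k.+1 * (y - x).
  by rewrite !(exprS _ k.+1); ring.
have xk : x ^+ k.+1 <= x by rewrite -[leRHS]expr1 ler_wiXn2l //; lra.
nra.
Qed.

(* Convexity of [t ^ m] on [x <= y <= 1]. *)
Lemma convex_exp (R : realFieldType) (x y : R) (m : nat) :
  0 <= x -> x <= y -> y <= 1 -> (1 - x) * y ^+ m <= (1 - y) * x ^+ m + (y - x).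
Proof.
move=> x0 xy y1; elim: m => [|m IH]; first by rewrite !expr0; lra.
have xm : x ^+ m <= 1 by apply: exprn_ile1 => //; lra.
have xm0 : 0 <= x ^+ m by apply: exprn_ge0.
rewrite !exprS; move: IH xm xm0; set X := x ^+ m; set Y := y ^+ m => IH xm xm0.
have h1 : y * ((1 - x) * Y) <= y * ((1 - y) * X + (y - x)) by rewrite ler_wpM2l //; lra.
have h2 : 0 <= (1 - y) * (y - x) * (1 - X) by rewrite !mulr_ge0 //; lra.
nra.
Qed.

Lemma exprN_even (R : realFieldType) (x : R) k : ~~ odd k -> (- x) ^+ k = x ^+ k.
Proof. by move=> ek; rewrite exprNn -signr_odd (negbTE ek) expr0 mul1r. Qed.

(* [core] below at [e1 = a] and [e2 = - b], for even [k] and [m]. *)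
Definition bal {R : realFieldType} (c : R) (l k m : nat) (a b : R) : R :=
  b ^+ m * (4 - a ^+ (2 * l) * c ^+ 2) * (2 - b ^+ k * c) * (1 - a)
  - a ^+ m * (4 - b ^+ (2 * l) * c ^+ 2) * (2 - a ^+ k * c) * (1 + b).

Section Bounds.
Variable R : realFieldType.
Implicit Types (a b c x : R) (l k m : nat).

Lemma normX_le1 x k : `|x| <= 1 -> `|x ^+ k| <= 1.
Proof. by move=> x1; rewrite normrX exprn_ile1. Qed.

Lemma lin_factor_gt0 x c k : `|x| <= 1 -> `|c| <= 1 -> 0 < 2 - x ^+ k * c.
Proof.
move=> /(@normX_le1 _ k) xk c1; have : `|x ^+ k * c| <= 1 by rewrite normrM mulr_ile1.
by rewrite ler_norml => /andP[_ h]; lra.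
Qed.

Lemma quad_factor_gt0 x c k : `|x| <= 1 -> `|c| <= 1 -> 0 < 4 - x ^+ k * c ^+ 2.
Proof.
move=> /(@normX_le1 _ k) xk /(@normX_le1 _ 2) c1.
have : `|x ^+ k * c ^+ 2| <= 1 by rewrite normrM mulr_ile1.
by rewrite ler_norml => /andP[_ h]; lra.
Qed.

Lemma quad_factor_le x y c l : `|x| <= y ->
  4 - y ^+ (2 * l) * c ^+ 2 <= 4 - x ^+ (2 * l) * c ^+ 2.
Proof.
move=> xy; rewrite lerD2l lerN2 ler_wpM2r ?sqr_ge0 //.
rewrite !exprM -(real_normK (num_real x)); apply: lerXn2r; rewrite ?nnegrE ?sqr_ge0 //.
by apply: lerXn2r; rewrite ?nnegrE //; apply: le_trans xy.
Qed.
End Bounds.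

(** By [subr_exp_le] the power grows by at most [y - x], which the growth [2 * (y - x)] of the
    linear term outweighs; the smaller coefficient at [y] only helps. *)
Lemma mul_lin_factor_le_anti (R : realFieldType) (x y c d : R) k :
  0 <= x -> x <= y -> x + y <= 1 -> 0 <= c -> c <= d -> c <= 1 ->
  x * (2 - x ^+ k * d) <= y * (2 - y ^+ k * c).
Proof.
move=> x0 xy xy1 c0 cd c1.
have := @subr_exp_le R x y k.+1 x0 xy xy1; rewrite !exprS => d1.
have p2 : 0 <= x * x ^+ k by rewrite -exprS exprn_ge0.
have p3 : x * x ^+ k <= y * y ^+ k by rewrite -!exprS; apply: lerXn2r; rewrite ?nnegrE; lra.
move: d1 p2 p3; rewrite !mulrBr !mulrA; set X := x * _; set Y := y * _ => d1 p2 p3.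
have h1 : X * c <= X * d by rewrite ler_wpM2l.
have h2 : (Y - X) * c <= Y - X by rewrite ler_piMr //; lra.
lra.
Qed.

(** Here the coefficient may grow with the argument. This costs at most [1 / 2 * (2 * (y - x))], the
    growth of the power at most [y - x], and the linear term pays for both. *)
Lemma mul_lin_factor_le (R : realFieldType) (x y c d : R) k :
  0 <= x -> x <= y -> y <= 1 / 2 -> 0 <= c -> d <= 1 -> d - c <= 2 * (y - x) ->
  x * (2 - x ^+ k * c) <= y * (2 - y ^+ k * d).
Proof.
move=> x0 xy y1 c0 d1 dc.
have := @subr_exp_le R x y k.+1 x0 xy; rewrite !exprS => dd.
have {}dd : y * y ^+ k - x * x ^+ k <= y - x by apply: dd; lra.
have q0 : 0 <= x * x ^+ k by rewrite -exprS exprn_ge0.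
have p3 : x * x ^+ k <= y * y ^+ k by rewrite -!exprS; apply: lerXn2r; rewrite ?nnegrE; lra.
have q1 : x * x ^+ k <= 1 / 2.
  rewrite -exprS; apply: (le_trans (y := x)); last lra.
  by rewrite -[leRHS]expr1; apply: ler_wiXn2l; rewrite //; lra.
move: dd q0 p3 q1; rewrite !mulrBr !mulrA; set X := x * _; set Y := y * _ => dd q0 p3 q1.
have h1 : X * (d - c) <= X * (2 * (y - x)) by rewrite ler_wpM2l.
have h2 : (Y - X) * d <= Y - X by rewrite ler_piMr //; lra.
have h3 : X * (2 * (y - x)) <= 1 / 2 * (2 * (y - x)) by rewrite ler_wpM2r //; lra.
lra.
Qed.

(** Clearing denominators leaves [y * x * (X * d ^+ 2 - Y * c ^+ 2) <= 4 * (y - x)], with [X] and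
    [Y] the powers of order [2 l + 1]; the bracket is at most [2 * (y - x)]. *)
Lemma quad_factor_div_le (R : realFieldType) (x y c d : R) l :
  0 < x -> x <= y -> y <= 1 / 2 -> 0 <= c -> c <= d -> d <= 1 / 4 -> d - c <= 3 * (y - x) ->
  (4 - y ^+ (2 * l.+1) * c ^+ 2) / y <= (4 - x ^+ (2 * l.+1) * d ^+ 2) / x.
Proof.
move=> x0 xy y1 c0 cd d1 dc.
have y0 : 0 < y by lra.
rewrite ler_pdivrMr // mulrAC ler_pdivlMr // mulnS addnC addn2 !(exprS _ _.+1).
have q1 : 0 <= x ^+ (2 * l).+1 by apply: exprn_ge0; lra.
have q2 : x ^+ (2 * l).+1 <= y ^+ (2 * l).+1 by apply: lerXn2r; rewrite ?nnegrE; lra.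
have q3 : y ^+ (2 * l).+1 <= 1 by apply: exprn_ile1; lra.
move: q1 q2 q3; set X := x ^+ _; set Y := y ^+ _ => q1 q2 q3.
have q4 : d ^+ 2 - c ^+ 2 <= 1 / 2 * (3 * (y - x)).
  have -> : d ^+ 2 - c ^+ 2 = (d + c) * (d - c) by ring.
  by apply: ler_pM; lra.
have q5 : X * d ^+ 2 - Y * c ^+ 2 <= 2 * (y - x).
  have h1 : 0 <= (Y - X) * c ^+ 2 by rewrite mulr_ge0 ?sqr_ge0 //; lra.
  have h2 : 0 <= d ^+ 2 - c ^+ 2 by rewrite subr_ge0; apply: lerXn2r; rewrite ?nnegrE; lra.
  have h3 : X * (d ^+ 2 - c ^+ 2) <= d ^+ 2 - c ^+ 2 by rewrite ler_piMl //; lra.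
  lra.
have h : y * x * (X * d ^+ 2 - Y * c ^+ 2) <= y * x * (2 * (y - x)).
  by rewrite ler_wpM2l // mulr_ge0; lra.
have yx : y * x <= 1 / 2 * (1 / 2) by apply: ler_pM; lra.
have h' : y * x * (2 * (y - x)) <= 1 / 2 * (1 / 2) * (2 * (y - x)) by rewrite ler_wpM2r //; lra.
move: xy h h'; clear; move=> xy h h'; lra.
Qed.

Lemma div_succ_le (R : realFieldType) (x y : R) : 0 < x -> x <= y -> x / (1 + x) <= y / (1 + y).
Proof.
move=> x0 xy; have y0 := lt_le_trans x0 xy.
rewrite ler_pdivrMr ?addr_gt0 // mulrAC ler_pdivlMr ?addr_gt0 //.
by rewrite !mulrDr !mulr1 (mulrC y x) lerD2r.
Qed.

(** The indices 1 and 2 stand for two values of [phi], the second larger. The hypothesis [2 <= m]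
    supplies the powers that make [b / (1 + b)] and [b * (2 - b ^+ k * c)] increase and
    [a * (2 - a ^+ k * c)] decrease. Strictness comes from [1 - a]. *)
Lemma bal_mono (R : realFieldType) (a1 a2 b1 b2 c1 c2 : R) l k m :
  0 < a2 -> a2 < a1 -> a1 <= 1 / 2 -> 0 < b1 -> b1 < b2 -> b2 <= 1 / 2 ->
  0 < c1 -> c1 < c2 -> c2 <= 1 / 4 ->
  c2 - c1 <= 3 * (a1 - a2) -> c2 - c1 <= 2 * (b2 - b1) ->
  (0 < l)%N -> (2 <= m)%N ->
  0 <= bal c1 l k m a1 b1 -> 0 < bal c2 l k m a2 b2.
Proof.
move=> a2_gt0 a21 a1_le b1_gt0 b12 b2_le c1_gt0 c12 c2_le ca cb.
case: l m => [//|l] [|[|m]] // _ _.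
have p1 : 0 < 1 + b1 by lra.
have p2 : 0 < 1 + b2 by lra.
have a1_gt0 : 0 < a1 by lra.
have b2_gt0 : 0 < b2 by lra.
have sa1 : 0 <= 1 - a1 by lra.
have n1 (x : R) : 0 < x -> x <= 1 -> `|x| <= 1 by move=> x0 x1; rewrite gtr0_norm.
have na1 : `|a1| <= 1 by apply: n1; lra.
have na2 : `|a2| <= 1 by apply: n1; lra.
have nb1 : `|b1| <= 1 by apply: n1; lra.
have nb2 : `|b2| <= 1 by apply: n1; lra.
have nc1 : `|c1| <= 1 by apply: n1; lra.
have nc2 : `|c2| <= 1 by apply: n1; lra.
have r3 : a2 * (2 - a2 ^+ k * c2) <= a1 * (2 - a1 ^+ k * c1).
  by apply: mul_lin_factor_le_anti; lra.
have l2 : b1 / (1 + b1) <= b2 / (1 + b2) by apply: div_succ_le => //; exact: ltW.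
have l3 : b1 * (2 - b1 ^+ k * c1) <= b2 * (2 - b2 ^+ k * c2).
  by apply: mul_lin_factor_le; lra.
have l4 : (4 - a1 ^+ (2 * l.+1) * c1 ^+ 2) / a1 <= (4 - a2 ^+ (2 * l.+1) * c2 ^+ 2) / a2.
  by apply: quad_factor_div_le; lra.
have v1 := lin_factor_gt0 k nb1 nc1.
have u1 := quad_factor_gt0 (2 * l.+1) na1 nc1.
have w1 : 0 < b1 / (1 + b1) by rewrite divr_gt0.
have w2 : 0 < (4 - a1 ^+ (2 * l.+1) * c1 ^+ 2) / a1 by rewrite divr_gt0.
have w3 : 0 < b1 * (2 - b1 ^+ k * c1) by rewrite mulr_gt0.
have w0 : 0 < b1 ^+ m by apply: exprn_gt0.
have w01 := mulr_gt0 w0 w1; have w013 := mulr_gt0 w01 w3; have P1_gt0 := mulr_gt0 w013 w2.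
have X (x y : R) j : 0 < x -> x < y -> x ^+ j <= y ^+ j.
  by move=> x0 xy; apply: lerXn2r; rewrite ?nnegrE; try exact: ltW; apply: ltW (lt_trans x0 xy).
have r1 : a2 ^+ m <= a1 ^+ m by exact: X.
have l1 : b1 ^+ m <= b2 ^+ m by exact: X.
have r2 : 4 - b2 ^+ (2 * l.+1) * c2 ^+ 2 <= 4 - b1 ^+ (2 * l.+1) * c1 ^+ 2.
  by rewrite lerD2l lerN2 ler_pM ?exprn_ge0 ?X // ltW.
have rhs : a2 ^+ m * (4 - b2 ^+ (2 * l.+1) * c2 ^+ 2) * (a2 * (2 - a2 ^+ k * c2))
    <= a1 ^+ m * (4 - b1 ^+ (2 * l.+1) * c1 ^+ 2) * (a1 * (2 - a1 ^+ k * c1)).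
  have u2 := quad_factor_gt0 (2 * l.+1) nb2 nc2.
  have v2 := lin_factor_gt0 k na2 nc2.
  have xm : 0 <= a2 ^+ m by rewrite exprn_ge0 // ltW.
  apply: ler_pM => //; last by apply: ler_pM => //; exact: ltW.
    by rewrite mulr_ge0 // ltW.
  by rewrite mulr_ge0 // ltW.
(* Up to the factor [a (1 + b)], the first term is a product of increasing factors
   and the second one a product of decreasing factors. *)
have red (a b c : R) : 0 < a -> 0 < 1 + b ->
    bal c l.+1 k m.+2 a b = a * (1 + b) *
      (b ^+ m * (b / (1 + b)) * (b * (2 - b ^+ k * c)) *
       ((4 - a ^+ (2 * l.+1) * c ^+ 2) / a) * (1 - a)
       - a ^+ m * (4 - b ^+ (2 * l.+1) * c ^+ 2) * (a * (2 - a ^+ k * c))).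
  by move=> a0 b0; rewrite /bal !exprS; field; rewrite !gt_eqF.
have q1 := mulr_gt0 a1_gt0 p1; have q2 := mulr_gt0 a2_gt0 p2.
rewrite !red // pmulr_rge0 // pmulr_rgt0 // subr_ge0 subr_gt0 => h.
apply: le_lt_trans rhs _; apply: le_lt_trans h _; move: P1_gt0.
set P1 := (X in X * (1 - a1)); set P2 := (X in X * (1 - a2)) => P1_gt0.
have P12 : P1 <= P2.
  rewrite /P1 /P2; apply: ler_pM => //; [exact: ltW|exact: ltW|].
  apply: ler_pM => //; [exact: ltW|exact: ltW|].
  by apply: ler_pM => //; exact: ltW.
apply: (le_lt_trans (y := P2 * (1 - a1))); first by rewrite ler_wpM2r.
by rewrite ltr_pM2l ?(lt_le_trans P1_gt0) // ltrD2l ltrN2.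
Qed.

(** * Comparison of consecutive functions inside the region *)

Section Order.
Variable R : realFieldType.
Variables (a b c : R).
Hypothesis abc : [/\ 0 < a, a < b, b <= 1 / 2, 0 < c & c <= 1 / 4].

Let na : `|a| <= 1. Proof. by case: abc => *; rewrite ger0_norm; lra. Qed.
Let nb : `|b| <= 1. Proof. by case: abc => *; rewrite ger0_norm; lra. Qed.
Let nc : `|c| <= 1. Proof. by case: abc => *; rewrite ger0_norm; lra. Qed.
Let Va k : 0 < 2 - a ^+ k * c. Proof. exact: lin_factor_gt0. Qed.
Let Vb k : 0 < 2 - b ^+ k * c. Proof. exact: lin_factor_gt0. Qed.
Let Ua k : 0 < 4 - a ^+ k * c ^+ 2. Proof. exact: quad_factor_gt0. Qed.
Let Ub k : 0 < 4 - b ^+ k * c ^+ 2. Proof. exact: quad_factor_gt0. Qed.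
Let am k : 0 < a ^+ k. Proof. by apply: exprn_gt0; case: abc. Qed.
Let bm k : 0 < b ^+ k. Proof. by case: abc => *; apply: exprn_gt0; lra. Qed.
Let ab_le k : a ^+ k <= b ^+ k.
Proof. by case: abc => *; apply: lerXn2r; rewrite ?nnegrE; lra. Qed.

Let sq_gt0 : 0 < a ^+ 2. Proof. exact: am. Qed.
Let sq_lt : a ^+ 2 < b ^+ 2.
Proof. by case: abc => a_gt0 ab _ _ _; rewrite !expr2 ltr_pM // ltW. Qed.
Let sq_le : b ^+ 2 <= 1 / 4.
Proof.
case: abc => a_gt0 ab b_le _ _; have -> : 1 / 4 = (1 / 2) ^+ 2 :> R by field.
by apply: lerXn2r; rewrite ?nnegrE ?divr_ge0 // ltW // (lt_trans a_gt0).
Qed.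
Let ab2 : 0 < b ^+ 2 - a ^+ 2. Proof. by rewrite subr_gt0. Qed.
Let csq_le : c ^+ 2 <= 1.
Proof. by case: abc => _ _ _ c0 c1; rewrite exprn_ile1 // ?ltW //; lra. Qed.

(** The function [t * (1 - t)] has slope at least [1 / 2] on [[0, 1 / 4]], where both squares lie.
    The explicit lower bound lets [bal_diag_succ] absorb a negative term. *)
Let concave k : b ^+ k * (b ^+ 2 - a ^+ 2) / 2 <=
  b ^+ k.+2 * (1 - b ^+ 2) - a ^+ k.+2 * (1 - a ^+ 2).
Proof.
rewrite -!(addn2 k) !exprD; move: sq_gt0 sq_lt sq_le (ab_le k) (bm k).
set A := a ^+ k; set B := b ^+ k; set x := a ^+ 2; set y := b ^+ 2.
clearbody A B x y; move=> x0 xy y1 AB B0.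
have h1 : 0 <= (B - A) * (x * (1 - x)) by rewrite !mulr_ge0 //; lra.
have h2 : 0 <= B * (y - x) * (1 / 2 - x - y) by rewrite !mulr_ge0 //; lra.
lra.
Qed.

(** Lowering [l] raises the quotient of [4 - a ^+ (2 * l) * c ^+ 2] by
    [4 - b ^+ (2 * l) * c ^+ 2]. *)
Lemma bal_pred l k m : (0 < l)%N -> 0 <= bal c l.+1 k m a b -> 0 < bal c l k m a b.
Proof.
case: abc => a_gt0 ab b_le c_gt0 c_le.
case: l => [//|l] _.
rewrite /bal !subr_ge0 !subr_gt0 => h.
pose p := b ^+ m * (2 - b ^+ k * c) * (1 - a); pose q := a ^+ m * (2 - a ^+ k * c) * (1 + b).
have p0 : 0 < p by rewrite !mulr_gt0 //; lra.
have := @lt_cross_transfer _ p q (4 - a ^+ (2 * l.+2) * c ^+ 2) (4 - b ^+ (2 * l.+2) * c ^+ 2)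
  (4 - a ^+ (2 * l.+1) * c ^+ 2) (4 - b ^+ (2 * l.+1) * c ^+ 2) p0 (Ub _) (Ub _).
move=> t.
suff : q * (4 - b ^+ (2 * l.+1) * c ^+ 2) < p * (4 - a ^+ (2 * l.+1) * c ^+ 2).
  by rewrite /p /q; congr (_ < _); ring.
apply: t; last by move: h; rewrite /p /q; congr (_ <= _); ring.
(* With [A] and [B] the powers of order [2 l + 2], the cross products differ by [4 * c ^+ 2 * (B *
   (1 - b ^+ 2) - A * (1 - a ^+ 2)) + c ^+ 4 * (A * B * (b ^+ 2 - a ^+ 2))]; [concave] makes the
   first bracket positive. *)
have := concave (2 * l); rewrite !mulnS !add2n.
have e (x : R) : x ^+ (2 * l).+4 = x ^+ (2 * l).+2 * x ^+ 2 by rewrite -exprD addn2.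
rewrite !e; have := am (2 * l).+2; have := bm (2 * l).+2; have := bm (2 * l).
set A := a ^+ (2 * l).+2; set B := b ^+ (2 * l).+2; set B' := b ^+ (2 * l) => h1 h2 h3 h4; clearbody A B B'.
have h5 : 0 < B' * (b ^+ 2 - a ^+ 2) by rewrite mulr_gt0.
have h6 : 0 < c ^+ 2 * (B * (1 - b ^+ 2) - A * (1 - a ^+ 2)).
  rewrite mulr_gt0 ?exprn_gt0 //; apply: lt_le_trans h4.
  by rewrite divr_gt0.
have h7 : 0 < c ^+ 4 * (A * B * (b ^+ 2 - a ^+ 2)) by rewrite mulr_gt0 ?exprn_gt0 ?mulr_gt0.
clear h h4 h5; lra.
Qed.

Lemma bal_diagE k m : bal c k k m a b = (2 - a ^+ k * c) * (2 - b ^+ k * c) *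
  (b ^+ m * (1 - a) * (2 + a ^+ k * c) - a ^+ m * (1 + b) * (2 + b ^+ k * c)).
Proof. by rewrite /bal !(mulnC 2) !exprM; ring. Qed.

(** The quotient of [2 + a ^+ k * c] by [2 + b ^+ k * c] grows when [k] is raised by 2. *)
Lemma bal_diag_succ k m : (2 <= k)%N -> 0 <= bal c k k m a b -> 0 < bal c k.+2 k.+2 m a b.
Proof.
case: abc => a_gt0 ab b_le c_gt0 c_le.
case: k => [//|[//|k]] _.
have vv j : 0 < (2 - a ^+ j * c) * (2 - b ^+ j * c) by rewrite mulr_gt0.
rewrite !bal_diagE pmulr_rge0 // pmulr_rgt0 // subr_ge0 subr_gt0.
have cA j : 0 < 2 + a ^+ j * c by rewrite addr_gt0 ?mulr_gt0 //.
have cB j : 0 < 2 + b ^+ j * c by rewrite addr_gt0 ?mulr_gt0 //.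
apply: lt_cross_transfer => //; first by rewrite mulr_gt0 //; lra.
(* The cross products differ by [2 * c * (B * (1 - b ^+ 2) - A * (1 - a ^+ 2)) - c ^+ 2 * (A * B *
   (b ^+ 2 - a ^+ 2))]. The first part is at least [c * (B' * (b ^+ 2 - a ^+ 2))]; [c <= 1 / 4] and
   [A * B <= B'] bound the second. *)
have := concave k.
have e (x : R) : x ^+ k.+4 = x ^+ k.+2 * x ^+ 2 by rewrite -exprD addn2.
rewrite !e.
have Ble : a ^+ k.+2 * b ^+ k.+2 <= b ^+ k.
  rewrite -(addn2 k) (exprD b) mulrCA ler_piMr ?(ltW (bm _)) //.
  have b0 : 0 <= b by apply: ltW; apply: lt_trans ab.
  have a0 := ltW a_gt0.
  by apply: mulr_ile1; rewrite ?exprn_ge0 ?exprn_ile1 //; lra.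
have := am k.+2; have := bm k.+2; have := bm k; move: Ble.
set A := a ^+ k.+2; set B := b ^+ k.+2; set B' := b ^+ k => h1 h2 h3 h4 h5; clearbody A B B'.
have h6 : 0 < c * (b ^+ 2 - a ^+ 2) by rewrite mulr_gt0.
have h7 : A * B * (c * (b ^+ 2 - a ^+ 2)) <= B' * (c * (b ^+ 2 - a ^+ 2)) by rewrite ler_pM2r.
have h8 : c * (B' * (c * (b ^+ 2 - a ^+ 2))) <= 1 / 4 * (B' * (c * (b ^+ 2 - a ^+ 2))).
  by rewrite ler_wpM2r // mulr_ge0 // ltW.
have h9 : 0 < B' * (c * (b ^+ 2 - a ^+ 2)) by rewrite mulr_gt0.
have h10 : c * (A * B * (c * (b ^+ 2 - a ^+ 2))) <= c * (B' * (c * (b ^+ 2 - a ^+ 2))).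
  by rewrite ler_pM2l.
have h11 := ler_wpM2l (ltW c_gt0) h5.
clear h1 h2 h3 h4 h5 h6 h7; lra.
Qed.

(** The new powers [b ^+ 2] and [a ^+ 2] outweigh the old even-power factors, by [subr_exp_le]
    applied to the squares; the new factors, of index [l.+2], are already ordered the right way. *)
Lemma bal_shift l k m : 0 <= bal c l k m a b -> 0 < bal c l.+2 k m.+2 a b.
Proof.
case: abc => a_gt0 ab b_le c_gt0 c_le.
rewrite /bal !subr_ge0 !subr_gt0 => h.
pose p := b ^+ m * (2 - b ^+ k * c) * (1 - a); pose q := a ^+ m * (2 - a ^+ k * c) * (1 + b).
have p0 : 0 < p by rewrite !mulr_gt0 //; lra.
have v0 : 0 < a ^+ 2 * (4 - b ^+ (2 * l.+2) * c ^+ 2) by rewrite mulr_gt0.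
have := @lt_cross_transfer _ p q (4 - a ^+ (2 * l) * c ^+ 2) (4 - b ^+ (2 * l) * c ^+ 2)
  (b ^+ 2 * (4 - a ^+ (2 * l.+2) * c ^+ 2)) (a ^+ 2 * (4 - b ^+ (2 * l.+2) * c ^+ 2)) p0 (Ub _) v0.
move=> t.
suff : q * (a ^+ 2 * (4 - b ^+ (2 * l.+2) * c ^+ 2)) < p * (b ^+ 2 * (4 - a ^+ (2 * l.+2) * c ^+ 2)).
  by rewrite /p /q -(addn2 m) !exprD; congr (_ < _); ring.
apply: t; last by move: h; rewrite /p /q; congr (_ <= _); ring.
have d : b ^+ (2 * l.+1) - a ^+ (2 * l.+1) <= b ^+ 2 - a ^+ 2.
  by rewrite !exprM; apply: subr_exp_le; nra.
have e (x : R) : x ^+ (2 * l.+1) = x ^+ (2 * l) * x ^+ 2 by rewrite mulnS addnC exprD.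
move: d; rewrite !e.
have ab_norm : `|a| <= b by rewrite gtr0_norm // ltW.
move: (@quad_factor_le R a b c l.+2 ab_norm).
move: (Ub (2 * l.+2)) (Ub (2 * l)).
set U := 4 - a ^+ (2 * l.+2) * _; set U' := 4 - b ^+ (2 * l.+2) * _ => U'_gt0 ub U_le d.
have h1 : a ^+ 2 * (4 - a ^+ (2 * l) * c ^+ 2) < b ^+ 2 * (4 - b ^+ (2 * l) * c ^+ 2).
  have d1 : c ^+ 2 * (b ^+ (2 * l) * b ^+ 2 - a ^+ (2 * l) * a ^+ 2) <= c ^+ 2 * (b ^+ 2 - a ^+ 2).
    by rewrite ler_wpM2l ?sqr_ge0.
  have d2 : c ^+ 2 * (b ^+ 2 - a ^+ 2) <= b ^+ 2 - a ^+ 2 by rewrite ler_piMl // ltW.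
  move: ab2 d1 d2; set A := a ^+ (2 * l); set B := b ^+ (2 * l); clearbody A B.
  move=> d3 d1 d2; clear h d ub U_le U'_gt0 v0; lra.
rewrite (mulrC (4 - a ^+ (2 * l) * c ^+ 2)) mulrAC [ltRHS]mulrAC.
apply: (lt_le_trans (y := b ^+ 2 * (4 - b ^+ (2 * l) * c ^+ 2) * U')).
  by rewrite ltr_pM2r.
by rewrite ler_wpM2l // mulr_ge0 ?sqr_ge0 // ltW.
Qed.
End Order.

(** * Signs at the ends of the range of [phi] *)

Lemma bal_lt0_c0 (R : realFieldType) (a : R) l k m : 0 < a -> bal 0 l k m a a < 0.
Proof.
move=> a0; have -> : bal 0 l k m a a = - (16 * a ^+ m * a).
  by rewrite /bal expr2 !mul0r !mulr0; ring.
by rewrite oppr_lt0 !mulr_gt0 ?exprn_gt0.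
Qed.

(** For [phi = phi2 rho], where [e1] vanishes and the second term with it. *)
Lemma bal_gt0_a0 (R : realFieldType) (b c : R) l k m :
  (0 < l)%N -> (0 < m)%N -> 0 < b -> b <= 1 -> `|c| <= 1 -> 0 < bal c l k m 0 b.
Proof.
case: l m => [//|l] [//|m] _ _ b0 b1 c1.
rewrite /bal mulnS add2n !expr0n /= !mul0r !subr0 mulr1.
by rewrite !mulr_gt0 ?exprn_gt0 ?lin_factor_gt0 // gtr0_norm.
Qed.

(** For [phi = 3 / 4]. Doubling gives [4 * a ^+ m <= b ^+ m], while the linear factors lose at most
    the ratio of [2 * (3 / 2)] to [7 / 4 * (3 / 4)], which is below 4. *)
Lemma bal_gt0_double (R : realFieldType) (a b c : R) l k m :
  (2 <= m)%N -> 0 < a -> 2 * a <= b -> b <= 1 / 2 -> 0 < c -> c <= 1 / 4 -> 0 < bal c l k m a b.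
Proof.
move=> m2 a0 ab b1 c0 c1; rewrite /bal subr_gt0.
have b0 : 0 < b by lra.
have b_le1 : b <= 1 by lra.
have nb : `|b| <= 1 by rewrite gtr0_norm.
have nc : `|c| <= 1 by rewrite gtr0_norm //; lra.
have ab_norm : `|a| <= b by rewrite gtr0_norm //; lra.
have a34 : 3 / 4 <= 1 - a by lra.
have b32 : 1 + b <= 3 / 2 by lra.
have pow : 4 * a ^+ m <= b ^+ m.
  case: m m2 => [|[|m]] // _; rewrite !exprS.
  have h1 : (2 * a) * ((2 * a) * a ^+ m) <= b * (b * b ^+ m).
    have am : 0 <= a ^+ m by rewrite exprn_ge0 // ltW.
    have abm : a ^+ m <= b ^+ m by apply: lerXn2r; rewrite ?nnegrE; lra.
    have aa : 0 <= 2 * a by lra.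
    by apply: ler_pM => //; [rewrite mulr_ge0|apply: ler_pM].
  by apply: le_trans h1; rewrite -!mulrA [a * (2 * _)]mulrCA !mulrA -natrM.
have U' := @quad_factor_gt0 R b c (2 * l) nb nc.
have UU := @quad_factor_le R a b c l ab_norm.
have am : 0 < a ^+ m by rewrite exprn_gt0.
have Vb : 7 / 4 <= 2 - b ^+ k * c.
  have h : b ^+ k * c <= 1 * (1 / 4).
    by apply: ler_pM => //; rewrite ?exprn_ge0 ?exprn_ile1 // ltW.
  lra.
have Va : 2 - a ^+ k * c <= 2 by rewrite lerBlDr lerDl mulr_ge0 ?exprn_ge0 // ltW.
have Va0 : 0 < 2 - a ^+ k * c.
  by apply: lin_factor_gt0 => //; exact: le_trans ab_norm b_le1.
move: U' UU am pow Vb Va Va0; set U := 4 - a ^+ _ * _; set U' := 4 - b ^+ _ * _.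
set A := a ^+ m; set B := b ^+ m; set V := 2 - b ^+ k * c; set V' := 2 - a ^+ k * c.
clearbody U U' A B V V'; move=> U'0 UU A0 AB Vb Va Va0.
have AU : 0 < A * U' by rewrite mulr_gt0.
have U0 : 0 < U by apply: lt_le_trans UU.
apply: (le_lt_trans (y := A * U' * 2 * (3 / 2))).
  apply: ler_pM => //; [by rewrite ltW // mulr_gt0|by lra|].
  by rewrite ler_pM2l.
apply: (lt_le_trans (y := 4 * A * U' * (7 / 4) * (3 / 4))); first by rewrite -(mulrA 4 A); lra.
have A4 : 0 <= 4 * A by rewrite mulr_ge0 // ltW.
have h1 : 4 * A * U' <= B * U by apply: ler_pM => //; exact: ltW.
have h0 : 0 <= 4 * A * U' by rewrite mulr_ge0 // ltW.
have h2 : 4 * A * U' * (7 / 4) <= B * U * V by apply: ler_pM => //; exact: divr_ge0.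
by apply: ler_pM => //; [rewrite mulr_ge0 // divr_ge0 | exact: divr_ge0].
Qed.

Definition core {R : realFieldType} (c : R) (l k m : nat) (x y : R) : R :=
  y ^+ m * (4 - x ^+ (2 * l) * c ^+ 2) * (2 - y ^+ k * c) * (1 - x)
  - x ^+ m * (4 - y ^+ (2 * l) * c ^+ 2) * (2 - x ^+ k * c) * (1 - y).

Lemma expr2l_N (R : realFieldType) (x : R) l : (- x) ^+ (2 * l) = x ^+ (2 * l).
Proof. by rewrite !exprM sqrrN. Qed.

Lemma core_even (R : realFieldType) (c x b : R) l k m : ~~ odd k -> ~~ odd m ->
  core c l k m x (- b) = bal c l k m x b.
Proof. by move=> ek em; rewrite /core /bal expr2l_N !exprN_even // opprK. Qed.

Lemma core_odd (R : realFieldType) (c x b : R) l k m : ~~ odd k -> odd m ->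
  core c l k m x (- b) =
  - (b ^+ m * (4 - x ^+ (2 * l) * c ^+ 2) * (2 - b ^+ k * c) * (1 - x)
    + x ^+ m * (4 - b ^+ (2 * l) * c ^+ 2) * (2 - x ^+ k * c) * (1 + b)).
Proof.
move=> ek om; rewrite /core expr2l_N (exprN_even b ek) opprK.
by rewrite (exprNn b m) -signr_odd om expr1; ring.
Qed.

Lemma even_le_sub2 j n : ~~ odd n -> ~~ odd j -> (j < n)%N -> (j <= n - 2)%N.
Proof. by lia. Qed.

(** * Signs along one period for all [phi] in [(2 / 3, 1]] *)

Section Range.
Variable R : realFieldType.
Variables (a b c : R).
Hypothesis abc : [/\ `|a| < b, b < 1, c = b - a & c <= 1].

Let a_lt : a < b. Proof. by case: abc => /ltr_normlP[]. Qed.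
Let na_lt : - a < b. Proof. by case: abc => /ltr_normlP[]. Qed.
Let b_lt1 : b < 1. Proof. by case: abc. Qed.
Let b_gt0 : 0 < b. Proof. by case: abc => h _ _ _; apply: le_lt_trans h. Qed.
Let c_gt0 : 0 < c. Proof. by case: abc => _ _ -> _; rewrite subr_gt0. Qed.
Let c_le1 : c <= 1. Proof. by case: abc. Qed.
Let cE : c = b - a. Proof. by case: abc. Qed.
Let na : `|a| <= 1. Proof. by case: abc => h1 h2 _ _; exact: ltW (lt_trans h1 h2). Qed.
Let nb : `|b| <= 1. Proof. by rewrite gtr0_norm ?ltW. Qed.
Let nc : `|c| <= 1. Proof. by rewrite gtr0_norm. Qed.
Let nab : `|a| <= b. Proof. by case: abc => /ltW. Qed.
Let Va k : 0 < 2 - a ^+ k * c. Proof. exact: lin_factor_gt0. Qed.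
Let Vb k : 0 < 2 - b ^+ k * c. Proof. exact: lin_factor_gt0. Qed.
Let Ua k : 0 < 4 - a ^+ k * c ^+ 2. Proof. exact: quad_factor_gt0. Qed.
Let Ub k : 0 < 4 - b ^+ k * c ^+ 2. Proof. exact: quad_factor_gt0. Qed.
Let bm k : 0 < b ^+ k. Proof. exact: exprn_gt0. Qed.
Let sa : 0 < 1 - a. Proof. by rewrite subr_gt0 (lt_trans a_lt). Qed.
Let sb : 0 < 1 + b. Proof. by rewrite addr_gt0. Qed.

(** With [a = - d], one spare power of each base goes into [d * (2 - d ^+ k * c) <= b * (2 - b ^+ k
    * c)], valid since [d + b = c <= 1], and another into [d * (1 + b) < b * (1 + d)]. *)
Lemma bal_gt0_npos l k m : ~~ odd k -> ~~ odd m -> (2 <= m)%N -> a <= 0 -> 0 < bal c l k m a b.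
Proof.
move=> ek em m2 a0; have [d [da d0 db dc]] : exists d, [/\ a = - d, 0 <= d, d < b & c = d + b].
  by exists (- a); rewrite opprK oppr_ge0 cE addrC.
rewrite /bal da expr2l_N !exprN_even // opprK subr_gt0.
case: m em m2 => [|[|m]] // _ _.
have U := Ub (2 * l); have UU : 4 - b ^+ (2 * l) * c ^+ 2 <= 4 - d ^+ (2 * l) * c ^+ 2.
  by apply: quad_factor_le; rewrite ger0_norm // ltW.
have dm : 0 <= d ^+ m by rewrite exprn_ge0.
have dbm : d ^+ m <= b ^+ m by apply: lerXn2r; rewrite ?nnegrE // ltW.
have W : d * (2 - d ^+ k * c) <= b * (2 - b ^+ k * c).
  by apply: mul_lin_factor_le_anti; rewrite // -?dc //; exact: ltW.
have Z : d * (1 + b) < b * (1 + d) by rewrite !mulrDr !mulr1 (mulrC d b) ltrD2r.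
have Wd : 0 <= d * (2 - d ^+ k * c).
  by rewrite mulr_ge0 // ltW // -(exprN_even d ek) -da.
have Zd : 0 <= d * (1 + b) by rewrite mulr_ge0 // ltW.
have bW : 0 < b * (2 - b ^+ k * c) by rewrite mulr_gt0.
have bU := lt_le_trans U UU.
rewrite -(addn2 m) !(exprD _ m).
have -> : d ^+ m * d ^+ 2 * (4 - b ^+ (2 * l) * c ^+ 2) * (2 - d ^+ k * c) * (1 + b)
  = d ^+ m * (4 - b ^+ (2 * l) * c ^+ 2) * (d * (2 - d ^+ k * c)) * (d * (1 + b)) by ring.
have -> : b ^+ m * b ^+ 2 * (4 - d ^+ (2 * l) * c ^+ 2) * (2 - b ^+ k * c) * (1 + d)
  = b ^+ m * (4 - d ^+ (2 * l) * c ^+ 2) * (b * (2 - b ^+ k * c)) * (b * (1 + d)) by ring.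
have P0 : 0 < b ^+ m * (4 - d ^+ (2 * l) * c ^+ 2) * (b * (2 - b ^+ k * c)).
  by rewrite mulr_gt0 // mulr_gt0.
apply: (le_lt_trans (y := b ^+ m * (4 - d ^+ (2 * l) * c ^+ 2) * (b * (2 - b ^+ k * c)) * (d * (1 + b)))).
  apply: ler_wpM2r => //; apply: ler_pM => //; first by rewrite mulr_ge0 // ltW.
  by apply: ler_pM => //; exact: ltW.
by rewrite ltr_pM2l.
Qed.

(** Since [a < b], lowering the exponent shrinks the positive term relative to the negative one. *)
Lemma bal_lt0_le l k m j : 0 < a -> (j <= m)%N -> bal c l k m a b < 0 -> bal c l k j a b < 0.
Proof.
move=> a0 /subnKC <-; rewrite /bal !subr_lt0 !(exprD _ j) => h.
set d := (m - j)%N in h.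
have dd : a ^+ d <= b ^+ d by apply: lerXn2r; rewrite ?nnegrE // ltW.
rewrite -(ltr_pM2r (bm d)).
set P := (X in X < _ * b ^+ d); set Q := (X in _ < X * b ^+ d).
have Q0 : 0 <= Q by rewrite /Q !mulr_ge0 ?exprn_ge0 // ltW.
apply: (lt_le_trans (y := Q * a ^+ d)); last by rewrite ler_wpM2l.
by move: h; rewrite /P /Q; congr (_ < _); ring.
Qed.

(** This links the two blocks of the pattern [[1, n, 1, n - 2]]. In the difference of cross products
    the terms in [c ^+ 2] cancel, and the rest is controlled by convexity of the power [k / 2 + 1]
    at the squares of [a] and [b]. *)
Lemma bal_ge0_shift l k m : ~~ odd k -> 0 <= a ->
  0 <= bal c l k.+2 m a b -> 0 <= bal c l k m.+2 a b.
Proof.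
move=> ek a0; rewrite /bal !subr_ge0 => h.
pose p := b ^+ m * (4 - a ^+ (2 * l) * c ^+ 2) * (1 - a).
pose q := a ^+ m * (4 - b ^+ (2 * l) * c ^+ 2) * (1 + b).
have p0 : 0 <= p by rewrite /p !mulr_ge0 // ltW.
suff : q * (a ^+ 2 * (2 - a ^+ k * c)) <= p * (b ^+ 2 * (2 - b ^+ k * c)).
  by rewrite /p /q -(addn2 m) !(exprD _ m); congr (_ <= _); ring.
have ab2 : a ^+ 2 <= b ^+ 2 by apply: lerXn2r; rewrite ?nnegrE // ltW.
have b21 : b ^+ 2 <= 1 by rewrite exprn_ile1 // ltW.
apply: (@le_cross_transfer _ p q (2 - b ^+ k.+2 * c) (2 - a ^+ k.+2 * c)) => //.
- by rewrite mulr_ge0 ?sqr_ge0 // ltW.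
- have := @convex_exp R (a ^+ 2) (b ^+ 2) k./2.+1 (sqr_ge0 _) ab2 b21.
  have ek2 : k = (2 * k./2)%N by rewrite mul2n halfK (negbTE ek) subn0.
  have e (x : R) : (x ^+ 2) ^+ k./2.+1 = x ^+ k * x ^+ 2 by rewrite -exprM mulnS -ek2 addnC exprD.
  rewrite !e -(addn2 k) !(exprD _ k); set A := a ^+ k; set B := b ^+ k.
  set x := a ^+ 2; set y := b ^+ 2; rewrite -/x -/y in ab2 b21.
  clearbody x y A B; clear h p0 p q e ek2 => h.
  have h1 := ler_wpM2r (ltW c_gt0) h.
  have h2 : (y - x) * c <= y - x by rewrite ler_piMr // subr_ge0.
  have h3 := ab2.
  by clear h; lra.
- by move: h; rewrite /p /q; congr (_ <= _); ring.
Qed.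

Lemma core_odd_lt0 l k m : ~~ odd k -> odd m -> 0 < a -> core c l k m a (- b) < 0.
Proof.
move=> ek om a0; have am : 0 < a ^+ m by exact: exprn_gt0.
by rewrite core_odd // oppr_lt0; apply: addr_gt0; do 3 (apply: mulr_gt0 => //).
Qed.

(** Serves the pattern [[1, 2]]. With [a = - d], the two sides of [W] differ by at least
    [(b - d) * (1 - d * b)]. *)
Lemma core1_lt0 l k : ~~ odd k -> a <= 0 -> core c l k 1 a (- b) < 0.
Proof.
move=> ek a0; have [d [da d0 db dc]] : exists d, [/\ a = - d, 0 <= d, d < b & c = d + b].
  by exists (- a); rewrite opprK oppr_ge0 cE addrC.
rewrite core_odd // da expr2l_N (exprN_even d ek) opprK !expr1 oppr_lt0 !mulNr subr_gt0.
have U := Ub (2 * l); have UU : 4 - b ^+ (2 * l) * c ^+ 2 <= 4 - d ^+ (2 * l) * c ^+ 2.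
  by apply: quad_factor_le; rewrite ger0_norm // ltW.
have W : d * (2 - d ^+ k * c) * (1 + b) < b * (2 - b ^+ k * c) * (1 + d).
  have h1 := @subr_exp_le R d b k.+1 d0 (ltW db); rewrite -dc in h1.
  have h2 := @subr_exp_le R d b k d0 (ltW db); rewrite -dc in h2.
  have {}h1 := h1 c_le1; have {}h2 := h2 c_le1.
  rewrite !exprS in h1.
  have bd0 : 0 <= d * b by rewrite mulr_ge0 // ltW.
  have bd1 : d * b < 1.
    by apply: (le_lt_trans (y := b)) b_lt1; rewrite ler_piMl ?(ltW b_gt0) // ltW // (lt_trans db).
  have h3 := ler_wpM2l bd0 h2.
  have h4 := ler_wpM2l (ltW c_gt0) h1.
  have h5 := ler_wpM2l (ltW c_gt0) h3.
  have h6 : c * (b - d) <= b - d by rewrite ler_piMl // subr_ge0 ltW.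
  have h7 := ler_wpM2l bd0 h6.
  have h8 : d * b * (b - d) < b - d by rewrite gtr_pMl // subr_gt0.
  by clear U UU h1 h2 h3 da dc; lra.
have Wd : 0 <= d * (2 - d ^+ k * c) * (1 + b).
  by rewrite mulr_ge0 ?(ltW sb) // mulr_ge0 // ltW // -(exprN_even d ek) -da.
have -> : d * (4 - b ^+ (2 * l) * c ^+ 2) * (2 - d ^+ k * c) * (1 + b)
  = (4 - b ^+ (2 * l) * c ^+ 2) * (d * (2 - d ^+ k * c) * (1 + b)) by ring.
have -> : b * (4 - d ^+ (2 * l) * c ^+ 2) * (2 - b ^+ k * c) * (1 + d)
  = (4 - d ^+ (2 * l) * c ^+ 2) * (b * (2 - b ^+ k * c) * (1 + d)) by ring.
apply: (le_lt_trans (y := (4 - d ^+ (2 * l) * c ^+ 2) * (d * (2 - d ^+ k * c) * (1 + b)))).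
  by rewrite ler_wpM2r.
by rewrite ltr_pM2l // (lt_le_trans U).
Qed.

Lemma bal_diag_0_lt0 k : ~~ odd k -> bal c k k 0 a b < 0.
Proof.
move=> ek; rewrite /bal !(mulnC 2) !exprM !expr0 !mul1r subr_lt0.
have ab2 : a ^+ k <= b ^+ k.
  have -> : k = (2 * k./2)%N by rewrite mul2n halfK (negbTE ek) subn0.
  rewrite !exprM -(real_normK (num_real a)).
  by apply: lerXn2r; rewrite ?nnegrE ?sqr_ge0 //; apply: lerXn2r; rewrite ?nnegrE // ltW.
have -> : (4 - (a ^+ k) ^+ 2 * c ^+ 2) * (2 - b ^+ k * c) * (1 - a) =
  (2 - a ^+ k * c) * (2 - b ^+ k * c) * ((2 + a ^+ k * c) * (1 - a)) by ring.
have -> : (4 - (b ^+ k) ^+ 2 * c ^+ 2) * (2 - a ^+ k * c) * (1 + b) =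
  (2 - a ^+ k * c) * (2 - b ^+ k * c) * ((2 + b ^+ k * c) * (1 + b)) by ring.
have Vab : 0 < (2 - a ^+ k * c) * (2 - b ^+ k * c) by rewrite mulr_gt0.
have h : 2 + a ^+ k * c <= 2 + b ^+ k * c by rewrite lerD2l ler_wpM2r // ltW.
have b2 : 0 < 2 + b ^+ k * c by rewrite addr_gt0 // mulr_gt0.
rewrite ltr_pM2l //; apply: (le_lt_trans (y := (2 + b ^+ k * c) * (1 - a))).
  by rewrite ler_wpM2r // ltW.
by rewrite ltr_pM2l // ltrD2l.
Qed.
Lemma core_diag_lt0 n : ~~ odd n -> (2 <= n)%N -> core c n n (n - 2) a (- b) < 0 ->
  forall j, (j < n)%N -> core c n n j a (- b) < 0.
Proof.
move=> en n2; have en2 : ~~ odd (n - 2) by rewrite oddB // (negbTE en).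
rewrite core_even // => h j jn.
(* For [a <= 0] the hypothesis contradicts [bal_gt0_npos] as soon as [n >= 4]; for [n = 2] the
   indices 0 and 1 are checked separately. *)
case: (lerP a 0) => a0.
  have [n3|n4] := leqP n 3; last first.
    have n4' : (2 <= n - 2)%N by rewrite leq_subRL.
    by have := @bal_gt0_npos n n (n - 2) en en2 n4' a0; rewrite ltNge ltW.
  have n22 : n = 2%N by case: n {h jn en2} en n2 n3 => [|[|[|[|]]]].
  rewrite n22; case: j jn => [|[|j]]; rewrite n22 // => _; last exact: core1_lt0.
  by rewrite core_even //; exact: bal_diag_0_lt0.
case: (boolP (odd j)) => [oj|ej]; first exact: core_odd_lt0.
by rewrite core_even //; apply: bal_lt0_le h => //; exact: even_le_sub2.
Qed.

Lemma core_double_lt0 n : ~~ odd n -> (4 <= n)%N ->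
  core c (n - 1) (n - 2) (n - 2) a (- b) < 0 -> 0 <= core c (n - 1) n (n - 2) a (- b) ->
  [/\ forall j, (j < n)%N -> core c (n - 1) (n - 2) j a (- b) < 0,
      0 <= core c (n - 1) (n - 2) n a (- b)
    & forall j, (j < n - 2)%N -> core c (n - 1) n j a (- b) < 0].
Proof.
case: n => [|[|[|[|n]]]] //; rewrite !subSS !subn0 /= !negbK => en _.
have en' : ~~ odd n.+2 by rewrite /= negbK.
rewrite !core_even //= ?negbK // => hG hH.
have a0 : 0 < a.
  rewrite ltNge; apply/negP => a0.
  by have := @bal_gt0_npos n.+3 n.+2 n.+2 en' en' isT a0; rewrite ltNge ltW.
split=> [j jn| |j jn].
- case: (boolP (odd j)) => [oj|ej]; first exact: core_odd_lt0.
  by rewrite core_even //; apply: bal_lt0_le hG => //; have := @even_le_sub2 j n.+4; rewrite subn2; apply=> //=; rewrite negbK.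
- by apply: bal_ge0_shift => //; exact: ltW.
- case: (boolP (odd j)) => [oj|ej]; first by apply: core_odd_lt0 => //=; rewrite negbK.
  (* Here [n] is the original one minus 4, the largest even index in question; negativity there is
     the contrapositive of [bal_ge0_shift] against [hG]. *)
  rewrite core_even //= ?negbK //; apply: (@bal_lt0_le _ _ n) => //.
    by have := @even_le_sub2 j n.+2; rewrite subn2; apply=> //=; rewrite negbK.
  rewrite ltNge; apply/negP => h.
  have := @bal_ge0_shift n.+3 n.+2 n en' (ltW a0) h.
  by rewrite leNgt hG.
Qed.
End Range.

(** * Eigenvalues of the transition matrix *)

(** The nonunit eigenvalues of [PB0 rho] are [- (1 / 2) + gap rho] and [- (1 / 2) - gap rho]. *)
Definition gap {R : realType} (rho : R) : R :=
  (1 - rho) * Srho rho / (2 * (1 + rho) * (1 + rho ^+ 2)).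

Section Eigenvalues.
Variable R : realType.
Implicit Types rho phi : R.

Lemma Srho_sq rho : 0 < rho -> Srho rho ^+ 2 = (1 + rho ^+ 2) * (1 + 4 * rho + rho ^+ 2).
Proof.
move=> r0; have r2 := exprn_gt0 2 r0.
by rewrite sqr_sqrtr // mulr_ge0 //; lra.
Qed.

Lemma gap_bounds rho : 0 < rho < 1 -> 0 < gap rho < 1 / 2.
Proof.
move=> /andP[r0 r1]; have r2 := exprn_gt0 2 r0.
have S0 : 0 < Srho rho by rewrite sqrtr_gt0 mulr_gt0 //; lra.
have D0 : 0 < 2 * (1 + rho) * (1 + rho ^+ 2) by rewrite !mulr_gt0 //; lra.
have N0 : 0 < (1 - rho) * Srho rho by rewrite mulr_gt0 // subr_gt0.
rewrite /gap divr_gt0 //= ltr_pdivrMr //.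
have -> : 1 / 2 * (2 * (1 + rho) * (1 + rho ^+ 2)) = (1 + rho) * (1 + rho ^+ 2) by field.
have M0 : 0 < (1 + rho) * (1 + rho ^+ 2) by rewrite mulr_gt0 //; lra.
rewrite -ltr_sqr ?nnegrE ?ltW // exprMn Srho_sq // -subr_gt0.
have -> : ((1 + rho) * (1 + rho ^+ 2)) ^+ 2 - (1 - rho) ^+ 2 * ((1 + rho ^+ 2) * (1 + 4 * rho + rho ^+ 2))
  = 8 * (1 + rho ^+ 2) * rho ^+ 2 by ring.
by rewrite !mulr_gt0 //; lra.
Qed.

Lemma e1E rho phi : e1 rho phi = 1 - phi * (3 / 2 - gap rho).
Proof. by rewrite /e1 -/(gap rho); field. Qed.

Lemma e2E rho phi : e2 rho phi = - (phi * (3 / 2 + gap rho) - 1).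
Proof. by rewrite /e2 -/(gap rho); field. Qed.

(** This identifies [phi2 rho] as the value of [phi] at which [e1] vanishes. *)
Lemma phi2E rho : 0 < rho < 1 -> phi2 rho = 1 / (3 / 2 - gap rho).
Proof.
move=> hr; have /andP[g0 g1] := @gap_bounds rho hr; case/andP: hr => r0 r1.
have r2 := exprn_gt0 2 r0.
have D0 : (1 + rho) * (1 + rho ^+ 2) != 0 by rewrite gt_eqF // mulr_gt0 //; lra.
have K0 : 3 / 2 - gap rho != 0 by rewrite gt_eqF //; lra.
have KE : 3 * (1 + rho) * (1 + rho ^+ 2) - (1 - rho) * Srho rho
    = (1 + rho) * (1 + rho ^+ 2) * (2 * (3 / 2 - gap rho)).
  by rewrite /gap; field; rewrite !gt_eqF //; lra.
rewrite /phi2 KE; move: K0 D0; set K := 3 / 2 - _; set D := _ * (1 + _) => K0 D0.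
by rewrite -(mulrA 2) -/D; field; rewrite K0 D0.
Qed.

Lemma KminusE rho phi : 0 < rho < 1 ->
  phi * Kminus rho = 2 * (1 + rho) * (1 + rho ^+ 2) * (1 - e1 rho phi).
Proof.
move=> /andP[r0 r1]; have r2 := exprn_gt0 2 r0.
by rewrite /Kminus /e1; field; rewrite !gt_eqF //; lra.
Qed.

Lemma KplusE rho phi : 0 < rho < 1 ->
  phi * Kplus rho = 2 * (1 + rho) * (1 + rho ^+ 2) * (1 - e2 rho phi).
Proof.
move=> /andP[r0 r1]; have r2 := exprn_gt0 2 r0.
by rewrite /Kplus /e2; field; rewrite !gt_eqF //; lra.
Qed.

(** The numbers [e1] and [- e2] lie symmetrically about [phi * gap rho], at distance
    [3 / 2 * phi - 1]; both quantities are positive. *)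
Lemma eigen_range rho phi : 0 < rho < 1 -> 2 / 3 < phi <= 1 ->
  [/\ `|e1 rho phi| < - e2 rho phi, - e2 rho phi < 1,
      3 * phi - 2 = - e2 rho phi - e1 rho phi & 3 * phi - 2 <= 1].
Proof.
move=> /gap_bounds /andP[g0 g1] /andP[p0 p1].
have h1 : 0 < phi * gap rho by rewrite mulr_gt0 //; lra.
have h2 : phi * gap rho < 1 / 2.
  by apply: (le_lt_trans (y := gap rho)) => //; rewrite ler_piMl // ltW.
rewrite e1E e2E !mulrBr !mulrDr; move: h1 h2; set u := phi * gap rho => h1 h2.
by split; [rewrite ltr_norml; apply/andP; split; lra|lra|lra|lra].
Qed.

Lemma region_range rho phi : region rho phi -> 2 / 3 < phi <= 1.
Proof. by move=> [_ [/andP[h1 h2] _]]; lra. Qed.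

Lemma region_bounds rho phi : region rho phi ->
  [/\ 0 < e1 rho phi, e1 rho phi < - e2 rho phi, - e2 rho phi <= 1 / 2,
      0 < 3 * phi - 2 & 3 * phi - 2 <= 1 / 4].
Proof.
move=> reg; have hr := region_range reg; case: reg => h [/andP[p0 p1] p2].
have [n1 _ cE _] := eigen_range h hr; move: p2; rewrite phi2E //.
have /andP[g0 g1] := gap_bounds h.
rewrite ltr_pdivlMr; last lra.
rewrite e1E e2E in n1 *; move: n1 => /ltr_normlP[_ n1] p2.
have : phi * gap rho <= 3 / 4 * (1 / 2) by apply: ler_pM; lra.
by split; lra.
Qed.

Definition core_at (l k m : nat) (rho phi : R) : R :=
  core (3 * phi - 2) l k m (e1 rho phi) (e2 rho phi).

Lemma core_at_bal l k m rho phi : ~~ odd k -> ~~ odd m ->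
  core_at l k m rho phi = bal (3 * phi - 2) l k m (e1 rho phi) (- e2 rho phi).
Proof. by move=> ek em; rewrite -core_even // opprK. Qed.

Lemma phi_norm rho phi : 2 / 3 < phi <= 1 -> `|3 * phi - 2| <= 1.
Proof. by move=> h; rewrite ler_norml; apply/andP; split; lra. Qed.

Lemma E_core n m rho phi : 0 < rho < 1 -> 2 / 3 < phi <= 1 ->
  exists2 q, 0 < q & E n m rho phi = q * core_at n n m rho phi.
Proof.
move=> hr hp; have [n1 n2 _ _] := eigen_range hr hp; have nc := @phi_norm rho phi hp.
have na : `|e1 rho phi| <= 1 by apply: ltW; apply: lt_trans n2.
have nb : `|e2 rho phi| <= 1.
  by rewrite -normrN gtr0_norm ?(ltW n2) //; apply: le_lt_trans n1.
have VA := @lin_factor_gt0 R _ _ n na nc.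
have VB := @lin_factor_gt0 R _ _ n nb nc.
have /andP[r0 r1] := hr; have r2 := exprn_gt0 2 r0.
(* Where [core] has differences of squares, [E] has only the factors with a plus sign; the others go
   into the constant. *)
exists (1 / 2 * (1 - rho) * (2 * (1 + rho) * (1 + rho ^+ 2))
   / ((2 - e1 rho phi ^+ n * (3 * phi - 2)) * (2 - e2 rho phi ^+ n * (3 * phi - 2)))).
  by rewrite divr_gt0 ?mulr_gt0 //; lra.
have := KminusE phi hr; have := KplusE phi hr.
rewrite /E /core_at /core !(mulnC 2) !exprM.
move: VA VB; move: (Kplus rho) (Kminus rho) (e1 rho phi ^+ n) (e2 rho phi ^+ n) => Kp Km A B.
move: (e1 rho phi) (e2 rho phi) (e1 rho phi ^+ m) (e2 rho phi ^+ m) => x y X Y VA VB hKp hKm.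
transitivity (1 / 2 * (1 - rho) * (Y * (2 + A * (3 * phi - 2)) * (phi * Km)
   - X * (2 + B * (3 * phi - 2)) * (phi * Kp))); first by ring.
by rewrite hKp hKm; field; rewrite !gt_eqF.
Qed.

Lemma G_core n m rho phi : 0 < rho < 1 ->
  exists2 q, 0 < q & G n m rho phi = q * core_at (n - 1) (n - 2) m rho phi.
Proof.
move=> hr; have /andP[r0 r1] := hr; have r2 := exprn_gt0 2 r0.
exists ((1 - rho) * (2 * (1 + rho) * (1 + rho ^+ 2))).
  by rewrite !mulr_gt0 //; lra.
have := KminusE phi hr; have := KplusE phi hr; rewrite /G /core_at /core.
move: (Kplus rho) (Kminus rho) (e1 rho phi ^+ m) (e2 rho phi ^+ m) => Kp Km X Y.
move: (e1 rho phi ^+ (2 * (n - 1))) (e2 rho phi ^+ (2 * (n - 1))) => X1 Y1.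
move: (e1 rho phi ^+ (n - 2)) (e2 rho phi ^+ (n - 2)) => X2 Y2.
move: (e1 rho phi) (e2 rho phi) => x y hKp hKm.
transitivity ((1 - rho) * (Y * (4 - X1 * (3 * phi - 2) ^+ 2) * (2 - Y2 * (3 * phi - 2)) * (phi * Km)
   - X * (4 - Y1 * (3 * phi - 2) ^+ 2) * (2 - X2 * (3 * phi - 2)) * (phi * Kp))); first by ring.
by rewrite hKp hKm; ring.
Qed.

Lemma H_core n m rho phi : 0 < rho < 1 ->
  exists2 q, 0 < q & H n m rho phi = q * core_at (n - 1) n m rho phi.
Proof.
move=> hr; have /andP[r0 r1] := hr; have r2 := exprn_gt0 2 r0.
exists ((1 - rho) * (2 * (1 + rho) * (1 + rho ^+ 2))).
  by rewrite !mulr_gt0 //; lra.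
have := KminusE phi hr; have := KplusE phi hr; rewrite /H /core_at /core.
move: (Kplus rho) (Kminus rho) (e1 rho phi ^+ m) (e2 rho phi ^+ m) => Kp Km X Y.
move: (e1 rho phi ^+ (2 * (n - 1))) (e2 rho phi ^+ (2 * (n - 1))) => X1 Y1.
move: (e1 rho phi ^+ n) (e2 rho phi ^+ n) => X2 Y2.
move: (e1 rho phi) (e2 rho phi) => x y hKp hKm.
transitivity ((1 - rho) * (Y * (4 - X1 * (3 * phi - 2) ^+ 2) * (2 - Y2 * (3 * phi - 2)) * (phi * Km)
   - X * (4 - Y1 * (3 * phi - 2) ^+ 2) * (2 - X2 * (3 * phi - 2)) * (phi * Kp))); first by ring.
by rewrite hKp hKm; ring.
Qed.

(** At fixed [rho] both eigenvalues are affine in [phi]; the polynomial form opens the way to the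
    intermediate value theorem. *)
Lemma core_at_horner l k m rho : exists p : {poly R}, forall phi, core_at l k m rho phi = p.[phi].
Proof.
pose c : {poly R} := 3%:P * 'X - 2%:P; pose x : {poly R} := 1 - 'X * (3 / 2 - gap rho)%:P.
pose y : {poly R} := - ('X * (3 / 2 + gap rho)%:P - 1).
exists (y ^+ m * (4%:P - x ^+ (2 * l) * c ^+ 2) * (2%:P - y ^+ k * c) * (1 - x)
  - x ^+ m * (4%:P - y ^+ (2 * l) * c ^+ 2) * (2%:P - x ^+ k * c) * (1 - y)).
by move=> phi; rewrite /core_at /core e1E e2E !hornerE.
Qed.
End Eigenvalues.

(** * The curves *)

Section Curves.
Variable R : realType.
Implicit Types (rho phi : R) (F : R -> R -> R).

(** The sign change along one vertical line; [implicit_curve] and [pos_above_neg_below] both follow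
    from it pointwise. *)
Definition crosses F rho (c : R) : Prop :=
  region rho c /\ forall phi, region rho phi ->
    [/\ phi = c -> F rho phi = 0, c < phi -> 0 < F rho phi & phi < c -> F rho phi < 0].

Lemma core_at_mono l k m rho phi1 phi2 : (0 < l)%N -> ~~ odd k -> ~~ odd m -> (2 <= m)%N ->
  region rho phi1 -> region rho phi2 -> phi1 < phi2 ->
  0 <= core_at l k m rho phi1 -> 0 < core_at l k m rho phi2.
Proof.
move=> l0 ek em m2 r1 r2 p12; rewrite !core_at_bal //.
have [a1 b1 c1 d1 f1] := region_bounds r1; have [a2 b2 c2 d2 f2] := region_bounds r2.
have /andP[g0 g1] := gap_bounds (proj1 r1).
have da : e1 rho phi1 - e1 rho phi2 = (phi2 - phi1) * (3 / 2 - gap rho) by rewrite !e1E; ring.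
have db : - e2 rho phi2 - - e2 rho phi1 = (phi2 - phi1) * (3 / 2 + gap rho) by rewrite !e2E; ring.
have p0 : 0 < phi2 - phi1 by rewrite subr_gt0.
(* [e1] falls with slope above 1 and [- e2] rises with slope above [3 / 2], against the slope 3 of
   [3 * phi - 2]; hence the constants 3 and 2 in [bal_mono]. *)
have h1 : (phi2 - phi1) * 1 < (phi2 - phi1) * (3 / 2 - gap rho) by rewrite ltr_pM2l //; lra.
have h2 : (phi2 - phi1) * (3 / 2) < (phi2 - phi1) * (3 / 2 + gap rho) by rewrite ltr_pM2l //; lra.
clear g0 g1 r1 r2; apply: bal_mono => //; lra.
Qed.

Lemma core_at_low l k m rho : ~~ odd k -> ~~ odd m -> 0 < rho < 1 ->
  core_at l k m rho (2 / 3) < 0.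
Proof.
move=> ek em h; have /andP[g0 g1] := gap_bounds h; rewrite core_at_bal // e1E e2E.
have -> : 3 * (2 / 3) - 2 = 0 :> R by field.
have -> : 1 - 2 / 3 * (3 / 2 - gap rho) = 2 / 3 * gap rho by field.
have -> : - - (2 / 3 * (3 / 2 + gap rho) - 1) = 2 / 3 * gap rho by field.
by apply: bal_lt0_c0; lra.
Qed.

(** The witness is the smaller of [phi2 rho] and [3 / 4]. It is not in the region itself, hence the
    open interval. *)
Lemma core_at_high l k m rho : (0 < l)%N -> ~~ odd k -> ~~ odd m -> (2 <= m)%N -> 0 < rho < 1 ->
  exists t, [/\ 2 / 3 < t, forall phi, 2 / 3 < phi < t -> region rho phi & 0 < core_at l k m rho t].
Proof.
move=> l0 ek em m2 h; have /andP[g0 g1] := gap_bounds h.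
have K0 : 0 < 3 / 2 - gap rho by lra.
have lo : 2 / 3 < phi2 rho by rewrite phi2E // ltr_pdivlMr //; lra.
have [hi|hi] := lerP (phi2 rho) (3 / 4).
  exists (phi2 rho); split=> // [phi /andP[q1 q2]|].
    by split=> //; split=> //; apply/andP; split=> //; apply: lt_le_trans hi.
  have rg : 2 / 3 < phi2 rho <= 1 by rewrite lo; apply: le_trans hi _; lra.
  have [n1 n2 cE c1] := eigen_range h rg.
  have e0 : e1 rho (phi2 rho) = 0.
    by rewrite e1E phi2E // mul1r mulVf ?subrr // gt_eqF.
  rewrite core_at_bal // e0; rewrite e0 normr0 in n1.
  by apply: bal_gt0_a0 => //; [exact: ltnW|exact: ltW|exact: phi_norm].
exists (3 / 4); split; [by lra| |].
  by move=> phi /andP[q1 q2]; split=> //; split; [apply/andP|apply: lt_trans hi].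
rewrite core_at_bal // e1E e2E.
(* [3 / 4 < phi2 rho] means [gap rho > 1 / 6], so [e1] is positive; [gap rho < 1 / 2] gives
   [2 * e1 <= - e2]. *)
move: hi; rewrite phi2E // ltr_pdivlMr // => hi.
by apply: bal_gt0_double => //; lra.
Qed.

Lemma core_at_crosses l k m rho : (0 < l)%N -> ~~ odd k -> ~~ odd m -> (2 <= m)%N ->
  0 < rho < 1 -> exists c, crosses (core_at l k m) rho c.
Proof.
move=> l0 ek em m2 h.
have [t [t0 treg ht]] := core_at_high l0 ek em m2 h.
have [p pE] := core_at_horner l k m rho.
have hl := @core_at_low l k m rho ek em h.
rewrite pE in ht; rewrite pE in hl.
have lh : p.[2 / 3] <= 0 <= p.[t] by rewrite !ltW.
have [c /andP[c1 c2] /rootP c0] := poly_ivt (ltW t0) lh.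
have cr : region rho c.
  apply: treg; apply/andP; split; rewrite lt_neqAle ?c1 ?c2 andbT; apply/eqP => e.
    by rewrite e c0 ltxx in hl.
  by rewrite -e c0 ltxx in ht.
exists c; split=> // phi pr; split=> [->|lt|lt]; first by rewrite pE.
  by apply: (core_at_mono l0 ek em m2 cr) => //; rewrite pE c0.
rewrite ltNge; apply/negP => ge.
by have := core_at_mono l0 ek em m2 pr cr lt ge; rewrite pE c0 ltxx.
Qed.

Lemma crosses_scale F F' rho c :
  (forall phi, region rho phi -> exists2 q, 0 < q & F rho phi = q * F' rho phi) ->
  crosses F' rho c -> crosses F rho c.
Proof.
move=> hF [cr hc]; split=> // phi pr; have [z p n] := hc phi pr.
have [q q0 ->] := hF phi pr; rewrite pmulr_rgt0 // pmulr_rlt0 //.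
by split=> // /z ->; rewrite mulr0.
Qed.

Lemma curve_of_crosses F : (forall rho, 0 < rho < 1 -> exists c, crosses F rho c) ->
  exists c : R -> R, forall rho, 0 < rho < 1 -> crosses F rho (c rho).
Proof.
move=> hF; have hc rho : exists c, 0 < rho < 1 -> crosses F rho c.
  case: (boolP (0 < rho < 1)) => [/hF[c hc]|_]; first by exists c.
  by exists 0.
by have [c] := choice hc; exists c.
Qed.

Lemma crosses_implicit F (c : R -> R) :
  (forall rho, 0 < rho < 1 -> crosses F rho (c rho)) -> implicit_curve F c.
Proof.
move=> hF rho h; have [cr hc] := hF rho h; split=> // phi pr; have [z p n] := hc phi pr.
split=> // F0; case: (ltgtP phi (c rho)) => // lt.
  by have := n lt; rewrite F0 ltxx.
by have := p lt; rewrite F0 ltxx.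
Qed.

Lemma crosses_signs F (c : R -> R) :
  (forall rho, 0 < rho < 1 -> crosses F rho (c rho)) -> pos_above_neg_below F c.
Proof.
by move=> hF rho phi pr; have [_ hc] := hF rho (proj1 pr); have [_ p n] := hc phi pr.
Qed.

(** At the zero of [F] the function [F'] is positive, so this point lies above the zero of [F']. *)
Lemma crosses_above F F' (c c' : R -> R) :
  (forall rho, 0 < rho < 1 -> crosses F rho (c rho)) ->
  (forall rho, 0 < rho < 1 -> crosses F' rho (c' rho)) ->
  (forall rho phi, region rho phi -> 0 <= F rho phi -> 0 < F' rho phi) -> above c c'.
Proof.
move=> hF hF' hFF rho h; have [cr hc] := hF rho h; have [cr' hc'] := hF' rho h.
have [z _ _] := hc _ cr; have [z' p' n'] := hc' _ cr.
have pos : 0 < F' rho (c rho) by apply: hFF => //; rewrite z.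
case: (ltgtP (c rho) (c' rho)) => // lt.
  by have := n' lt; rewrite ltNge (ltW pos).
by rewrite z' // ltxx in pos.
Qed.

Lemma E_scale n m rho phi : region rho phi ->
  exists2 q, 0 < q & E n m rho phi = q * core_at n n m rho phi.
Proof. by move=> pr; apply: E_core (region_range pr); case: pr. Qed.

Lemma G_scale n m rho phi : region rho phi ->
  exists2 q, 0 < q & G n m rho phi = q * core_at (n - 1) (n - 2) m rho phi.
Proof. by move=> pr; apply: G_core; case: pr. Qed.

Lemma H_scale n m rho phi : region rho phi ->
  exists2 q, 0 < q & H n m rho phi = q * core_at (n - 1) n m rho phi.
Proof. by move=> pr; apply: H_core; case: pr. Qed.

Lemma scale_imply F F' F1 F1' :
  (forall rho phi, region rho phi -> exists2 q, 0 < q & F rho phi = q * F1 rho phi) ->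
  (forall rho phi, region rho phi -> exists2 q, 0 < q & F' rho phi = q * F1' rho phi) ->
  (forall rho phi, region rho phi -> 0 <= F1 rho phi -> 0 < F1' rho phi) ->
  forall rho phi, region rho phi -> 0 <= F rho phi -> 0 < F' rho phi.
Proof.
move=> h h' hi rho phi pr; have [q q0 ->] := h _ _ pr; have [q' q'0 ->] := h' _ _ pr.
by rewrite pmulr_rge0 // pmulr_rgt0 //; exact: hi.
Qed.

Lemma ordered_curves n : ~~ odd n -> (4 <= n)%N ->
    exists cG cE cE' cH cG' : R -> R,
      (implicit_curve (G n (n - 2)) cG /\
       implicit_curve (E (n - 2) (n - 2)) cE /\
       implicit_curve (E n (n - 2)) cE' /\
       implicit_curve (H n (n - 2)) cH /\
       implicit_curve (G (n + 2) n) cG') /\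
      (above cG cE /\ above cE cE' /\ above cE' cH /\ above cH cG') /\
      (pos_above_neg_below (G n (n - 2)) cG /\
       pos_above_neg_below (E (n - 2) (n - 2)) cE /\
       pos_above_neg_below (E n (n - 2)) cE' /\
       pos_above_neg_below (H n (n - 2)) cH /\
       pos_above_neg_below (G (n + 2) n) cG').
Proof.
case: n => [|[|[|[|n]]]] //; rewrite addn2 !subSS subn0 /= !negbK => en _.
have en2 : ~~ odd n.+2 by rewrite /= negbK.
have en4 : ~~ odd n.+4 by rewrite /= !negbK.
have curve F l k m :
    (forall rho phi, region rho phi -> exists2 q, 0 < q & F rho phi = q * core_at l k m rho phi) ->
    (0 < l)%N -> ~~ odd k -> ~~ odd m -> (2 <= m)%N ->
    exists c : R -> R, forall rho, 0 < rho < 1 -> crosses F rho (c rho).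
  move=> hF l0 ek em m2; apply: curve_of_crosses => rho hr.
  have [c hc] := core_at_crosses l0 ek em m2 hr.
  by exists c; apply: crosses_scale hc => phi; exact: hF.
have sG := @G_scale n.+4 n.+2; have sE := @E_scale n.+2 n.+2; have sE' := @E_scale n.+4 n.+2.
have sH := @H_scale n.+4 n.+2; have sG' := @G_scale n.+4.+2 n.+4.
rewrite !subSS !subn0 in sG sE sE' sH sG'.
have [cG hG] := curve _ _ _ _ sG isT en2 en2 isT.
have [cE hE] := curve _ _ _ _ sE isT en2 en2 isT.
have [cE' hE'] := curve _ _ _ _ sE' isT en4 en2 isT.
have [cH hH] := curve _ _ _ _ sH isT en4 en2 isT.
have [cG' hG'] := curve _ _ _ _ sG' isT en4 en4 isT.
exists cG, cE, cE', cH, cG'; split.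
  by split; [|split; [|split; [|split]]]; exact: crosses_implicit.
split; last by split; [|split; [|split; [|split]]]; exact: crosses_signs.
split; [|split; [|split]]; [apply: (crosses_above hG hE)|apply: (crosses_above hE hE')|
  apply: (crosses_above hE' hH)|apply: (crosses_above hH hG')].
(* With [N = n.+4], the indices [(l, k, m)] run through [(N-1, N-2, N-2)], [(N-2, N-2, N-2)],
   [(N, N, N-2)], [(N-1, N, N-2)], [(N+1, N, N)]. *)
- apply: scale_imply sG sE _ => rho phi pr; rewrite !core_at_bal //.
  by apply: bal_pred => //; exact: region_bounds.
- apply: scale_imply sE sE' _ => rho phi pr; rewrite !core_at_bal //.
  by apply: bal_diag_succ => //; exact: region_bounds.
- apply: scale_imply sE' sH _ => rho phi pr; rewrite !core_at_bal //.
  by apply: bal_pred => //; exact: region_bounds.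
- apply: scale_imply sH sG' _ => rho phi pr; rewrite !core_at_bal //.
  by apply: bal_shift => //; exact: region_bounds.
Qed.
End Curves.

(** * Stochastic matrices and stationary distributions *)

Section Stochastic.
Variables (R : realFieldType) (n : nat).
Implicit Types (x : 'rV[R]_n) (M N : 'M[R]_n).

Definition mass x : R := \sum_i x 0 i.
Definition l1norm x : R := \sum_i `|x 0 i|.
Definition stochastic M : Prop := (forall i j, 0 <= M i j) /\ forall i, \sum_j M i j = 1.

Lemma mass_mul M x : stochastic M -> mass (x *m M) = mass x.
Proof.
move=> [_ M1]; rewrite /mass; under eq_bigr do rewrite mxE.
by rewrite exchange_big; apply: eq_bigr => i _; rewrite -mulr_sumr M1 mulr1.
Qed.

Lemma stochastic_mul M N : stochastic M -> stochastic N -> stochastic (M *m N).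
Proof.
move=> [M0 M1] [N0 N1]; split=> [i j|i].
  by rewrite mxE sumr_ge0 // => k _; rewrite mulr_ge0.
under eq_bigr do rewrite mxE.
rewrite exchange_big -[RHS](M1 i); apply: eq_bigr => k _.
by rewrite -mulr_sumr N1 mulr1.
Qed.

Lemma l1norm_mul M x : stochastic M -> l1norm (x *m M) <= l1norm x.
Proof.
move=> [M0 M1]; rewrite /l1norm.
apply: (le_trans (y := \sum_j \sum_i `|x 0 i| * M i j)).
  apply: ler_sum => j _; rewrite mxE; apply: le_trans (ler_norm_sum _ _ _) _.
  by apply: ler_sum => i _; rewrite normrM (ger0_norm (M0 i j)).
rewrite exchange_big; apply: ler_sum => i _.
by rewrite -mulr_sumr M1 mulr1.
Qed.

Lemma l1norm_scale (a : R) x : l1norm (a *: x) = `|a| * l1norm x.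
Proof. by rewrite /l1norm mulr_sumr; apply: eq_bigr => i _; rewrite mxE normrM. Qed.

Lemma l1norm_eq0 x : l1norm x <= 0 -> x = 0.
Proof.
move=> x0; apply/rowP => i; rewrite mxE; apply/eqP; rewrite -normr_eq0.
have : l1norm x == 0 by rewrite eq_le x0 sumr_ge0.
by rewrite psumr_eq0 // => /allP /(_ i (mem_index_enum i)).
Qed.

Lemma mass_scale (a : R) x : mass (a *: x) = a * mass x.
Proof. by rewrite /mass mulr_sumr; apply: eq_bigr => i _; rewrite mxE. Qed.

Lemma mass_sub x y : mass (x - y) = mass x - mass y.
Proof. by rewrite /mass -sumrB; apply: eq_bigr => i _; rewrite !mxE. Qed.
End Stochastic.

Lemma stochastic_exp (R : realFieldType) n (M : 'M[R]_n.+1) k : stochastic M -> stochastic (M ^+ k).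
Proof.
move=> sM; elim: k => [|k IH]; last by rewrite exprS; exact: stochastic_mul.
rewrite expr0; split=> [i j|i]; first by rewrite mxE ler0n.
rewrite (bigD1 i) //= mxE eqxx big1 ?addr0 // => j ji.
by rewrite mxE eq_sym (negbTE ji).
Qed.

Section Fixed.
Variables (R : realFieldType) (n : nat) (M : 'M[R]_n.+1).
Hypothesis sM : stochastic M.
Hypothesis no_zero_sum_fixed : forall d : 'rV[R]_n.+1, mass d = 0 -> d *m M = d -> d = 0.

(** The constant column lies in the kernel of [1 - M], so some nonzero row does too; its mass is
    nonzero by [no_zero_sum_fixed] and can be normalised. *)
Lemma exists_fixed_mass1 : exists x : 'rV[R]_n.+1, mass x = 1 /\ x *m M = x.
Proof.
have d0 : \det (1%:M - M)^T == 0.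
  apply/det0P; exists (const_mx 1).
    by apply/eqP => /rowP /(_ 0); rewrite !mxE => /eqP; rewrite oner_eq0.
  apply: trmx_inj; rewrite trmx_mul trmxK trmx0 mulmxBl mul1mx; apply/colP => i.
  rewrite !mxE [X in _ - X](_ : _ = 1) ?subrr //.
  by rewrite -[RHS](sM.2 i); apply: eq_bigr => j _; rewrite !mxE mulr1.
rewrite det_tr in d0; have /det0P[v v0 hv] := d0.
have fv : v *m M = v by apply/eqP; rewrite eq_sym -subr_eq0 -{1}(mulmx1 v) -mulmxBr hv.
have tv : mass v != 0 by apply/eqP => /no_zero_sum_fixed /(_ fv) e; rewrite e eqxx in v0.
exists ((mass v)^-1 *: v); rewrite mass_scale mulVf //; split=> //.
by rewrite -scalemxAl fv.
Qed.

(* [|x| M] dominates [|x|] and has the same mass, so [|x|] is fixed too. *)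
Lemma fixed_ge0 x : mass x = 1 -> x *m M = x -> forall i, 0 <= x 0 i.
Proof.
move=> x1 fx; pose y : 'rV[R]_n.+1 := \row_i `|x 0 i|.
have ge i : y 0 i <= (y *m M) 0 i.
  rewrite mxE -{1}fx mxE; apply: le_trans (ler_norm_sum _ _ _) _; rewrite [leRHS]mxE.
  by apply: ler_sum => j _; rewrite normrM (ger0_norm (sM.1 j i)) mxE.
have fy : y *m M = y.
  apply/rowP => i; apply/eqP; rewrite -subr_eq0.
  have : \sum_i ((y *m M) 0 i - y 0 i) == 0 by rewrite sumrB -/(mass _) mass_mul // subrr.
  rewrite psumr_eq0; last by move=> j _; rewrite subr_ge0.
  by move=> /allP /(_ i (mem_index_enum i)).
have y1 : 1 <= mass y.
  by rewrite -x1; apply: ler_sum => i _; rewrite mxE ler_norm.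
have /eqP : y - mass y *: x = 0.
  apply: no_zero_sum_fixed; first by rewrite mass_sub mass_scale x1 mulr1 subrr.
  by rewrite mulmxBl fy -scalemxAl fx.
rewrite subr_eq0 => /eqP e i.
have : 0 <= y 0 i by rewrite mxE.
by rewrite e mxE pmulr_rge0 // (lt_le_trans ltr01).
Qed.
End Fixed.

(** * The two games as stochastic matrices *)

Section Games.
Variable R : realType.
Implicit Types (rho phi : R) (x : 'rV[R]_3).

Lemma unique_stationary (M : 'M[R]_3) : stochastic M ->
  (forall d : 'rV[R]_3, mass d = 0 -> d *m M = d -> d = 0) ->
  exists x : 'rV[R]_3, unique (stationary M) x.
Proof.
move=> sM nz; have [x [x1 fx]] := exists_fixed_mass1 sM nz.
exists x; split=> [|z [[_ z1] fz]].
  by do !split=> //; exact: fixed_ge0 sM nz _ x1 fx.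
apply/eqP; rewrite -subr_eq0; apply/eqP; apply: nz.
  by rewrite mass_sub x1 -[mass z]/(\sum_i z 0 i) z1 subrr.
by rewrite mulmxBl fx fz.
Qed.

Definition o1 : 'I_3 := lift ord0 ord0.
Definition o2 : 'I_3 := lift ord0 (lift ord0 ord0).

Lemma sum3 (f : 'I_3 -> R) : \sum_i f i = f ord0 + f o1 + f o2.
Proof. by rewrite !big_ord_recl big_ord0 addr0 addrA. Qed.

Lemma ord3_ind (P : 'I_3 -> Prop) : P ord0 -> P o1 -> P o2 -> forall i, P i.
Proof.
move=> h0 h1 h2 [[|[|[|//]]] hi].
- by rewrite (_ : Ordinal hi = ord0) //; exact: val_inj.
- by rewrite (_ : Ordinal hi = o1) //; exact: val_inj.
- by rewrite (_ : Ordinal hi = o2) //; exact: val_inj.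
Qed.

Lemma mulPB rho phi x :
  [/\ (x *m PB rho phi) 0 ord0 = (1 - phi) * x 0 ord0 + phi * ((1 - p1 rho) * x 0 o1 + p1 rho * x 0 o2),
      (x *m PB rho phi) 0 o1 = (1 - phi) * x 0 o1 + phi * (p0 rho * x 0 ord0 + (1 - p1 rho) * x 0 o2)
    & (x *m PB rho phi) 0 o2 = (1 - phi) * x 0 o2 + phi * ((1 - p0 rho) * x 0 ord0 + p1 rho * x 0 o1)].
Proof.
by split; rewrite /PB mulmxDr mul_mx_scalar -scalemxAr !mxE sum3 !mxE /=; ring.
Qed.

Lemma mulPA phi x : x *m PA phi = (1 - 3 / 2 * phi) *: x + (phi / 2 * mass x) *: const_mx 1.
Proof.
apply/rowP; rewrite /mass sum3.
by apply: ord3_ind; rewrite /PA mulmxDr mul_mx_scalar -scalemxAr !mxE sum3 !mxE /=; field.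
Qed.

Lemma stochastic_mx3 (M : 'M[R]_3) :
  (forall i j, 0 <= M i j) -> (forall i, M i ord0 + M i o1 + M i o2 = 1) -> stochastic M.
Proof. by move=> h0 h1; split=> // i; rewrite sum3. Qed.

Lemma stochastic_PA phi : 0 < phi <= 1 -> stochastic (PA phi).
Proof.
move=> /andP[h0 h1]; apply: stochastic_mx3.
  by do 2 apply: ord3_ind; rewrite !mxE /= ?mulr1n ?mulr0n; lra.
by apply: ord3_ind; rewrite !mxE /= ?mulr1n ?mulr0n; field.
Qed.

Lemma p0_bounds rho : 0 < rho -> 0 <= p0 rho <= 1.
Proof.
move=> r0; have r2 := exprn_gt0 2 r0; have D : 0 < 1 + rho ^+ 2 by lra.
by rewrite /p0 (divr_ge0 (ltW r2) (ltW D)) /= ler_pdivrMr // mul1r lerDr.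
Qed.

Lemma p1_bounds rho : 0 < rho -> 0 <= p1 rho <= 1.
Proof.
move=> r0; have D : 0 < 1 + rho by lra.
by rewrite /p1 (divr_ge0 ler01 (ltW D)) /= ler_pdivrMr // mul1r lerDl ltW.
Qed.

Lemma stochastic_PB rho phi : 0 < rho -> 0 < phi <= 1 -> stochastic (PB rho phi).
Proof.
move=> r0 /andP[h0 h1]; have /andP[a0 a1] := p0_bounds r0; have /andP[b0 b1] := p1_bounds r0.
apply: stochastic_mx3.
  do 2 apply: ord3_ind; rewrite !mxE /= ?mulr1n ?mulr0n ?add0r ?mulr0 ?addr0 ?subr_ge0 //;
  by rewrite mulr_ge0 ?subr_ge0 ?(ltW h0).
by apply: ord3_ind; rewrite !mxE /= ?mulr1n ?mulr0n; ring.
Qed.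
End Games.

(** * The greedy orbit *)

Section Dynamics.
Variable R : realType.
Implicit Types (x y : 'rV[R]_3).
Variables (rho phi : R).
Hypotheses (hrho : 0 < rho < 1) (hphi : 2 / 3 < phi <= 1).

Local Notation A := (PA phi).
Local Notation B := (PB rho phi).
Local Notation lam := (1 - 3 / 2 * phi).
Local Notation c := (3 * phi - 2).
Local Notation e1 := (e1 rho phi).
Local Notation e2 := (e2 rho phi).

Let phi_gt0 : 0 < phi <= 1.
Proof. by move: hphi => /andP[h1 h2]; rewrite h2 andbT; lra. Qed.
Let rho_gt0 : 0 < rho. Proof. by case/andP: hrho. Qed.
Let sA : stochastic A. Proof. exact: stochastic_PA. Qed.
Let sB : stochastic B. Proof. exact: stochastic_PB. Qed.
Let sBn n : stochastic (B ^+ n). Proof. exact: stochastic_exp. Qed.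

Definition dev x : R := x 0 0 - pi0 rho.
Definition eigdev (f : R) x : R := dev (x *m B) - f * dev x.
(** One play of A sends [dev] to [lam] times [dev] minus [drive]. *)
Definition drive : R := (1 - lam) * (pi0 rho - 1 / 3).

Lemma drive_gt0 : 0 < drive.
Proof.
have /andP[r0 r1] := hrho; have /andP[h0 h1] := hphi; have r2 := exprn_gt0 2 r0.
rewrite /drive mulr_gt0 //; first by lra.
have -> : pi0 rho - 1 / 3 = (1 - rho) ^+ 2 / (6 * (1 + rho + rho ^+ 2)).
  by rewrite /pi0; field; rewrite gt_eqF //; lra.
by rewrite divr_gt0 // ?mulr_gt0 ?exprn_gt0 ?subr_gt0 //; lra.
Qed.

Lemma e_sum : e1 + e2 = 2 - 3 * phi.
Proof. by rewrite e1E e2E; field. Qed.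

Lemma e_sub : e1 - e2 = 2 * phi * gap rho.
Proof. by rewrite e1E e2E; field. Qed.

Lemma gap_sq : gap rho ^+ 2 =
  (1 - rho) ^+ 2 * (1 + 4 * rho + rho ^+ 2) / (4 * (1 + rho) ^+ 2 * (1 + rho ^+ 2)).
Proof.
have r0 := rho_gt0; have r2 := exprn_gt0 2 r0.
rewrite /gap expr_div_n exprMn Srho_sq //.
by field; rewrite !gt_eqF //; lra.
Qed.

(** Cayley-Hamilton for [B] on zero-sum rows; there is no constant term because [pi0] is the
    stationary first coordinate. *)
Lemma dev_PB2 x : mass x = 1 ->
  dev (x *m B *m B) - (e1 + e2) * dev (x *m B) + e1 * e2 * dev x = 0.
Proof.
move=> tx; have r0 := rho_gt0; have r2 := exprn_gt0 2 r0.
have -> : e1 * e2 = (1 - 3 / 2 * phi) ^+ 2 - phi ^+ 2 * gap rho ^+ 2 by rewrite e1E e2E; field.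
rewrite e_sum gap_sq /dev.
have [-> _ _] := mulPB rho phi (x *m B); have [-> -> ->] := mulPB rho phi x.
have x2 : x 0 o2 = 1 - x 0 ord0 - x 0 o1 by rewrite -tx /mass sum3; ring.
rewrite x2 /p0 /p1 /pi0.
by field; rewrite !gt_eqF //; lra.
Qed.

Lemma eigdev_PB e f x : (e = e1 /\ f = e2) \/ (e = e2 /\ f = e1) -> mass x = 1 ->
  eigdev f (x *m B) = e * eigdev f x.
Proof.
move=> ef tx; have := dev_PB2 tx; rewrite /eigdev.
move: (dev (x *m B *m B)) (dev (x *m B)) (dev x) => u v w.
by case: ef => -[-> ->] h; apply/eqP; rewrite -subr_eq0 -h; apply/eqP; ring.
Qed.

Lemma eigdev_PBn e f x n : (e = e1 /\ f = e2) \/ (e = e2 /\ f = e1) -> mass x = 1 ->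
  eigdev f (x *m B ^+ n) = e ^+ n * eigdev f x.
Proof.
move=> ef tx; elim: n => [|n IH]; first by rewrite !expr0 mulmx1 mul1r.
rewrite exprSr -[_ * B]/(_ *m B) mulmxA (eigdev_PB ef) ?mass_mul // IH.
by rewrite exprS mulrA.
Qed.

Lemma dev_spectral x n : mass x = 1 ->
  (e1 - e2) * dev (x *m B ^+ n) = e1 ^+ n * eigdev e2 x - e2 ^+ n * eigdev e1 x.
Proof.
move=> tx; rewrite -(eigdev_PBn n (or_introl (conj erefl erefl)) tx).
by rewrite -(eigdev_PBn n (or_intror (conj erefl erefl)) tx) /eigdev; ring.
Qed.

(** A play of A moves the state towards the uniform distribution, where [dev] is unchanged by [B]
    because the first column of [PB0] sums to 1. *)
Lemma eigdev_PA f x : mass x = 1 -> eigdev f (x *m A) = lam * eigdev f x - drive * (1 - f).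
Proof.
move=> tx; have r0 := rho_gt0; have r2 := exprn_gt0 2 r0.
rewrite /eigdev /dev mulPA tx mulr1.
have [-> _ _] := mulPB rho phi (lam *: x + (phi / 2) *: const_mx 1).
have [-> _ _] := mulPB rho phi x.
have x2 : x 0 o2 = 1 - x 0 ord0 - x 0 o1 by rewrite -tx /mass sum3; ring.
rewrite !mxE x2 /drive /p0 /p1 /pi0.
by field; rewrite !gt_eqF //; lra.
Qed.

(** Going once round the cycle gives a linear equation for each [eigdev] at [x *m A]; solving both
    and inserting them in [dev_spectral] produces [core]. *)
Lemma dev_block l k m x y : (k + m = 2 * l)%N ->
  mass x = 1 -> mass y = 1 ->
  x *m A *m B ^+ m = y -> y *m A *m B ^+ k = x ->
  exists2 q, 0 < q & forall j, dev (x *m A *m B ^+ j) = q * core_at l k j rho phi.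
Proof.
move=> kml tx ty xy yx.
have tA z : mass z = 1 -> mass (z *m A) = 1 by move=> <-; exact: mass_mul.
have key e f : (e = e1 /\ f = e2) \/ (e = e2 /\ f = e1) ->
    eigdev f (x *m A) * (4 - e ^+ (2 * l) * c ^+ 2) = - (2 * drive * (1 - f) * (2 - e ^+ k * c)).
  move=> ef.
  have h1 := eigdev_PA f tx; have h2 := eigdev_PBn m ef (tA _ tx).
  have h3 := eigdev_PA f ty; have h4 := eigdev_PBn k ef (tA _ ty).
  rewrite xy in h2; rewrite yx in h4.
  rewrite -kml exprD; move: h1 h2 h3 h4.
  move: (eigdev f (x *m A)) (eigdev f x) (eigdev f (y *m A)) (eigdev f y) (e ^+ m) (e ^+ k).
  move=> a b a' b' em ek h1 h2 h3 h4; rewrite h4 h3 h2 in h1.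
  apply/eqP; rewrite -subr_eq0; apply/eqP.
  (* The factor 4 clears the square of [lam = - c / 2]. *)
  transitivity (4 * (a - (lam * (ek * (lam * (em * a) - drive * (1 - f))) - drive * (1 - f)))).
    by field.
  by rewrite -h1 subrr mulr0.
have [n1 n2 _ _] := eigen_range hrho hphi; have nc := @phi_norm _ rho phi hphi.
have na : `|e1| <= 1 by apply: ltW; apply: lt_trans n2.
have nb : `|e2| <= 1 by rewrite -normrN gtr0_norm ?(ltW n2) //; apply: le_lt_trans n1.
have U1 := @quad_factor_gt0 R _ _ (2 * l) na nc.
have U2 := @quad_factor_gt0 R _ _ (2 * l) nb nc.
have es : 0 < e1 - e2.
  have /andP[p0 _] := phi_gt0; have /andP[g0 _] := gap_bounds hrho.
  by rewrite e_sub; apply: mulr_gt0 => //; lra.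
exists (2 * drive / ((e1 - e2) * (4 - e1 ^+ (2 * l) * c ^+ 2) * (4 - e2 ^+ (2 * l) * c ^+ 2))).
  have d0 := drive_gt0; apply: divr_gt0; first by lra.
  by do 2 apply: mulr_gt0 => //.
move=> j; have := dev_spectral j (tA _ tx).
have := key _ _ (or_introl (conj erefl erefl)); have := key _ _ (or_intror (conj erefl erefl)).
rewrite /core_at /core.
have es' : e1 - e2 != 0 by rewrite gt_eqF.
have U1' := lt0r_neq0 U1; have U2' := lt0r_neq0 U2.
move: (dev _) (eigdev e1 _) (eigdev e2 _) es' U1' U2' => d h1 h2.
move: (4 - e1 ^+ (2 * l) * _) (4 - e2 ^+ (2 * l) * _) (2 - e1 ^+ k * _) (2 - e2 ^+ k * _) => u1 u2 v1 v2.
move: (e1 ^+ j) (e2 ^+ j) => a b es' U1' U2' k1 k2 hd.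
apply: (mulfI es'); apply: (mulIf U1'); apply: (mulIf U2'); rewrite hd.
transitivity (a * u2 * (h2 * u1) - b * u1 * (h1 * u2)); first by ring.
by rewrite k1 k2; field; rewrite es' U1' U2'.
Qed.

Lemma zero_sum_PA (d : 'rV[R]_3) : mass d = 0 -> d *m A = lam *: d.
Proof. by move=> d0; rewrite mulPA d0 mulr0 scale0r addr0. Qed.

(** On zero-sum rows A is multiplication by [lam], of absolute value at most [1 / 2], and [M] does
    not increase the l1 norm. *)
Lemma zero_sum_PA_stochastic (M : 'M[R]_3) (d : 'rV[R]_3) : stochastic M ->
  mass d = 0 -> d *m (A *m M) = d -> d = 0.
Proof.
move=> sM d0 fd; apply: l1norm_eq0.
have h : l1norm d <= 1 / 2 * l1norm d.
  rewrite -{1}fd mulmxA (zero_sum_PA d0); apply: le_trans (l1norm_mul _ sM) _.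
  rewrite l1norm_scale ler_wpM2r ?sumr_ge0 // ler_norml.
  by case/andP: hphi => h1 h2; apply/andP; split; lra.
lra.
Qed.

Lemma unique_stationary_A (M : 'M[R]_3) : stochastic M ->
  exists x : 'rV[R]_3, unique (stationary (A *m M)) x.
Proof.
move=> sM; apply: unique_stationary; first exact: stochastic_mul.
by move=> d; exact: zero_sum_PA_stochastic sM.
Qed.

(** * Finite runs of the greedy strategy *)

Definition game_mx (g : game) : 'M[R]_3 := if g is GameA then A else B.
Definition play x (s : seq game) := foldl (fun z g => z *m game_mx g) x s.

Fixpoint follows x (s : seq game) : Prop :=
  if s is g :: s' then greedy_game rho x = g /\ follows (x *m game_mx g) s' else True.

Lemma play_cat x s1 s2 : play x (s1 ++ s2) = play (play x s1) s2.
Proof. exact: foldl_cat. Qed.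

Lemma follows_cat x s1 s2 : follows x (s1 ++ s2) <-> follows x s1 /\ follows (play x s1) s2.
Proof.
elim: s1 x => [|g s1 IH] x /=; first by split=> [|[]].
by rewrite IH; split=> [[? []]|[[]]].
Qed.

Lemma greedy_stepE x : greedy_step rho phi x = x *m game_mx (greedy_game rho x).
Proof. by rewrite /greedy_step; case: greedy_game. Qed.

Lemma follows_iter x s : follows x s ->
  (forall k, (k < size s)%N -> greedy_game rho (iter k (greedy_step rho phi) x) = nth GameA s k)
  /\ iter (size s) (greedy_step rho phi) x = play x s.
Proof.
elim: s x => [|g s IH] x //= [gx /IH[h1 h2]].
have e : greedy_step rho phi x = x *m game_mx g by rewrite greedy_stepE gx.
split=> [[|k] //=|]; first by rewrite ltnS => /h1; rewrite -e -iterSr.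
by rewrite -h2 -e -iterSr.
Qed.

Lemma iter_follows x s :
  (forall k, (k < size s)%N -> greedy_game rho (iter k (greedy_step rho phi) x) = nth GameA s k) ->
  follows x s.
Proof.
elim: s x => [//|g s IH] x h /=; have gx := h 0%N isT; rewrite /= in gx.
split=> //; apply: IH => k ks; have := h k.+1; rewrite ltnS => /(_ ks).
by rewrite iterSr greedy_stepE gx.
Qed.

(** Since a full block returns to [x], the infinite condition reduces to one period. *)
Lemma greedy_follows x s : (0 < size s)%N -> play x s = x ->
  greedy_leads_to rho phi s x <-> follows x s.
Proof.
move=> sz px.
split=> [h|/follows_iter[h1 h2] k].
  by apply: iter_follows => k ks; rewrite h modn_small.
rewrite px in h2; rewrite -h1 ?ltn_mod //; congr (greedy_game rho _).
rewrite {1}(divn_eq k (size s)) addnC iterD; congr iter.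
elim: (k %/ size s)%N => [//|q IH].
by rewrite mulSn addnC iterD h2.
Qed.

Lemma play_Bn x n : play x (nseq n GameB) = x *m B ^+ n.
Proof.
elim: n x => [|n IH] x /=; first by rewrite expr0 mulmx1.
by rewrite [LHS]IH exprS -[_ * B ^+ n]/(_ *m B ^+ n) mulmxA.
Qed.

Lemma greedy_A x : greedy_game rho x = GameA <-> 0 <= dev x.
Proof. by rewrite /greedy_game /dev subr_ge0; case: ifP. Qed.

Lemma greedy_B x : greedy_game rho x = GameB <-> dev x < 0.
Proof. by rewrite /greedy_game /dev subr_lt0 ltNge; case: ifP. Qed.

Lemma follows_Bn x n : follows x (nseq n GameB) <-> forall j, (j < n)%N -> dev (x *m B ^+ j) < 0.
Proof.
elim: n x => [//|n IH] x /=; rewrite greedy_B IH; split=> [[h1 h2] [|j] jn|h].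
- by rewrite expr0 mulmx1.
- by rewrite exprS -[_ * B ^+ j]/(_ *m B ^+ j) mulmxA; exact: h2.
- split; first by have := h 0%N isT; rewrite expr0 mulmx1.
  by move=> j jn; have := h j.+1 jn; rewrite exprS -[_ * B ^+ j]/(_ *m B ^+ j) mulmxA.
Qed.

(** * The patterns [[1, n]] and [[1, n, 1, n - 2]] *)

Lemma follows_1n x n : follows x (pattern1n n) <->
  0 <= dev x /\ forall j, (j < n)%N -> dev (x *m A *m B ^+ j) < 0.
Proof. by rewrite /pattern1n /= greedy_A follows_Bn. Qed.

Lemma play_1n x n : play x (pattern1n n) = x *m A *m B ^+ n.
Proof. by rewrite /pattern1n /=; exact: play_Bn. Qed.

Lemma pattern1n_iff n : ~~ odd n -> (2 <= n)%N ->
  exists pi : 'rV[R]_3,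
    unique (stationary (A *m B ^+ n)) pi /\
    (greedy_leads_to rho phi (pattern1n n) pi <->
     E n (n - 2) rho phi < 0 /\ 0 <= E n n rho phi).
Proof.
move=> en n2; have [x ux] := unique_stationary_A (sBn n).
exists x; split=> //; case: ux => -[[_ x1] fx] _; rewrite mulmxA in fx.
have tx : mass x = 1 by [].
rewrite greedy_follows ?play_1n // follows_1n.
have nn : (n + n = 2 * n)%N by rewrite mul2n addnn.
(* The pattern [[1, n]] is the degenerate cycle with both halves equal. Its starting state is also
   the state after [n] plays of B, so the condition for playing A has index [n]. *)
have [q q0 hq] := dev_block nn tx tx fx fx.
have [u u0 hu] := @E_core _ n (n - 2) rho phi hrho hphi.
have [v v0 hv] := @E_core _ n n rho phi hrho hphi.
rewrite hu hv pmulr_rlt0 // pmulr_rge0 //.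
have -> : dev x = q * core_at n n n rho phi by rewrite -hq fx.
rewrite pmulr_rge0 //; split=> [[h1 h2]|[h1 h2]]; split=> //.
  have /h2 : (n - 2 < n)%N by rewrite ltn_subrL (leq_trans _ n2).
  by rewrite hq pmulr_rlt0.
move=> j jn; rewrite hq pmulr_rlt0 //.
have := @core_diag_lt0 R _ _ _ (eigen_range hrho hphi) n en n2; rewrite /core_at opprK in h1 *.
exact.
Qed.

Lemma E20_lt0 : E 2 0 rho phi < 0.
Proof.
have [q q0 ->] := @E_core _ 2 0 rho phi hrho hphi; rewrite pmulr_rlt0 // core_at_bal //.
exact: bal_diag_0_lt0 (eigen_range hrho hphi) 2 isT.
Qed.

Lemma pattern1n2_iff n : ~~ odd n -> (4 <= n)%N ->
  exists pi : 'rV[R]_3,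
    unique (stationary (A *m B ^+ n *m A *m B ^+ (n - 2))) pi /\
    (greedy_leads_to rho phi (pattern1n n ++ pattern1n (n - 2)) pi <->
     G n (n - 2) rho phi < 0 /\ 0 <= H n (n - 2) rho phi).
Proof.
move=> en n4.
have sM : stochastic (B ^+ n *m (A *m B ^+ (n - 2))) by do !apply: stochastic_mul.
have [x] := unique_stationary_A sM; rewrite !mulmxA => ux.
exists x; split=> //; case: ux => -[[_ x1] fx] _; rewrite !mulmxA in fx.
have tx : mass x = 1 by [].
pose y := x *m A *m B ^+ n.
have ty : mass y = 1 by rewrite !mass_mul.
have yx : y *m A *m B ^+ (n - 2) = x by [].
have n2 : (2 <= n)%N by apply: leq_trans n4.
have kG : (n - 2 + n = 2 * (n - 1))%N by rewrite mulnBr mul2n -addnn addnC addnBA.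
have kH : (n + (n - 2) = 2 * (n - 1))%N by rewrite addnC.
(* The cycle is read from [x], where [n - 2] plays of B close it, and from [y], where [n] plays do;
   this yields the expressions for [G] and [H]. *)
have [q q0 hq] := dev_block kG tx ty (erefl y) yx.
have [q' q'0 hq'] := dev_block kH ty tx yx (erefl y).
rewrite greedy_follows //; last by rewrite play_cat !play_1n.
rewrite follows_cat play_1n !follows_1n -/y.
have [u u0 ->] := @G_core _ n (n - 2) rho phi hrho.
have [v v0 ->] := @H_core _ n (n - 2) rho phi hrho.
rewrite pmulr_rlt0 // pmulr_rge0 //.
have -> : dev x = q' * core_at (n - 1) n (n - 2) rho phi by rewrite -hq' yx.
have -> : dev y = q * core_at (n - 1) (n - 2) n rho phi by rewrite -hq.
rewrite !pmulr_rge0 //; split=> [[[h1 h2] _]|[h1 h2]].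
  split=> //; have /h2 : (n - 2 < n)%N by rewrite ltn_subrL (leq_trans _ n2).
  by rewrite hq pmulr_rlt0.
have := @core_double_lt0 R _ _ _ (eigen_range hrho hphi) n en n4.
rewrite /core_at opprK in h1 h2 *; move=> /(_ h1 h2) [k1 k2 k3].
split; split=> // j jn; first by rewrite hq pmulr_rlt0 //; exact: k1.
by rewrite hq' pmulr_rlt0 //; exact: k3.
Qed.
End Dynamics.

Theorem theorem6 (R : realType) :
  (* (i) *)
  (forall n : nat, ~~ odd n -> (4 <= n)%N ->
    exists cG cE cE' cH cG' : R -> R,
      (implicit_curve (G n (n - 2)) cG /\
       implicit_curve (E (n - 2) (n - 2)) cE /\
       implicit_curve (E n (n - 2)) cE' /\
       implicit_curve (H n (n - 2)) cH /\
       implicit_curve (G (n + 2) n) cG') /\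
      (above cG cE /\ above cE cE' /\ above cE' cH /\ above cH cG') /\
      (pos_above_neg_below (G n (n - 2)) cG /\
       pos_above_neg_below (E (n - 2) (n - 2)) cE /\
       pos_above_neg_below (E n (n - 2)) cE' /\
       pos_above_neg_below (H n (n - 2)) cH /\
       pos_above_neg_below (G (n + 2) n) cG'))
  /\
  (* (ii) *)
  ((forall (n : nat) (rho phi : R), ~~ odd n -> (2 <= n)%N ->
     0 < rho < 1 -> 2 / 3 < phi <= 1 ->
     exists pi : 'rV[R]_3,
       unique (stationary (PA phi *m PB rho phi ^+ n)) pi /\
       (greedy_leads_to rho phi (pattern1n n) pi <->
        E n (n - 2) rho phi < 0 /\ 0 <= E n n rho phi)) /\
   (forall rho phi : R, 0 < rho < 1 -> 2 / 3 < phi <= 1 ->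
     E 2 0 rho phi < 0))
  /\
  (* (iii) *)
  (forall (n : nat) (rho phi : R), ~~ odd n -> (4 <= n)%N ->
     0 < rho < 1 -> 2 / 3 < phi <= 1 ->
     exists pi : 'rV[R]_3,
       unique (stationary (PA phi *m PB rho phi ^+ n
                             *m PA phi *m PB rho phi ^+ (n - 2))) pi /\
       (greedy_leads_to rho phi (pattern1n n ++ pattern1n (n - 2)) pi <->
        G n (n - 2) rho phi < 0 /\ 0 <= H n (n - 2) rho phi)).
Proof.
split; first exact: ordered_curves.
split; last by move=> n rho phi en n4 hr hp; exact: pattern1n2_iff.
split; first by move=> n rho phi en n2 hr hp; exact: pattern1n_iff.
exact: E20_lt0.
Qed.
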